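(* Let $n\ge1$, $1<p<\infty$, $0\le\gamma<1$ and $\gamma<\alpha<1$. There exists a (small) number $s_0=s_0(n,p,\gamma,\alpha)>0$ such that the following holds for every $0<s\le s_0$. There exist positive constants $A$, $B$, depending only on $n,p,\gamma,\alpha$, such that for every parabolic rectangle $R\subset\mathbb R^{n+1}$ and every $f\in\mathrm{PBMO}^+_{\gamma,0,s}(R)$ with $\|f\|=\|f\|_{\mathrm{PBMO}^+_{\gamma,0,s}(R)}>0$ there exists $c_R\in\mathbb R$ such that \[ |R^{+}(\alpha)\cap\{(f-c_R)_+>\lambda\}|\le Ae^{-B\lambda/\|f\|}\,|R^{+}(\alpha)| \] and \[ |R^{-}(\alpha)\cap\{(f-c_R)_->\lambda\}|\le Ae^{-B\lambda/\|f\|}\,|R^{-}(\alpha)| \] for every $\lambda>0$.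
   Context: Points of $\mathbb R^{n+1}$ are written $(x,t)$ with $x\in\mathbb R^n$, $t\in\mathbb R$; $|E|$ is Lebesgue measure. Write $g_+=\max\{g,0\}$, $g_-=-\min\{g,0\}$. For $x\in\mathbb R^n$ and $L>0$ let $Q(x,L)=\{y\in\mathbb R^n:|y_i-x_i|\le L,\ i=1,\dots,n\}$. A parabolic rectangle (in the $p$-geometry, $1<p<\infty$ fixed) centered at $(x,t)$ with side length $L>0$ is $R=R(x,t,L)=Q(x,L)\times(t-L^p,t+L^p)$. For $-1<\gamma<1$ its upper and lower parts are $R^+(\gamma)=Q(x,L)\times(t+\gamma L^p,t+L^p)$ and $R^-(\gamma)=Q(x,L)\times(t-L^p,t-\gamma L^p)$. For $0<s\le1$, a measurable set $E\subset\mathbb R^{n+1}$ with $0<|E|<\infty$ and a measurable function $g:E\to[-\infty,\infty]$, the maximal $s$-median of $g$ over $E$ is $m_g^s(E)=\inf\{a\in\mathbb R:|\{z\in E:g(z)>a\}|<s|E|\}$. Median-type parabolic BMO: for $0\le\gamma<1$ and $0<s\le1$, a measurable function $f:R\to[-\infty,\infty]$ belongs to $\mathrm{PBMO}^+_{\gamma,0,s}(R)$ if \[ \|f\|_{\mathrm{PBMO}^+_{\gamma,0,s}(R)}=\sup_{P\subset R}\ \inf_{c\in\mathbb R}\Big(m^s_{(f-c)_+}(P^+(\gamma))+m^s_{(f-c)_-}(P^-(\gamma))\Big)<\infty, \] where the supremum is over all parabolic rectangles $P\subset R$ (including $R$ itself). (Here the subscript $0$ is only part of the notation for the median-type space.)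 *)

(* Defs.v *)
From HB Require Import structures.
From mathcomp Require Import all_boot all_order all_algebra.
From mathcomp Require Import all_classical all_reals all_analysis.
From mathcomp Require Import measurable_realfun.

Set Implicit Arguments.
Unset Strict Implicit.
Unset Printing Implicit Defensive.

Import Order.TTheory GRing.Theory Num.Theory.
Import numFieldNormedType.Exports.

Local Open Scope classical_set_scope.
Local Open Scope ring_scope.

Section tuple_lebesgue_measure.
Context {R : realType}.
Local Notation B := (measurableTypeR R).

Definition tuple_cons n (z : B * n.-tuple B) : n.+1.-tuple B :=
  [tuple of z.1 :: z.2].

Lemma measurable_tuple_cons n : measurable_fun setT (@tuple_cons n).
Proof. by apply: measurable_cons; [exact: measurable_fst|exact: measurable_snd]. Qed.

Section step.
Variables (n : nat) (mu : {sigma_finite_measure set (n.-tuple B) -> \bar R}).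

Definition lebesgue_cons : set (n.+1.-tuple B) -> \bar R :=
  pushforward (@lebesgue_measure R \x mu)%E (@tuple_cons n).

Let lebesgue_cons0 : lebesgue_cons set0 = 0%E.
Proof. by rewrite /lebesgue_cons /pushforward preimage_set0 measure0. Qed.

Let lebesgue_cons_ge0 A : (0 <= lebesgue_cons A)%E.
Proof. by rewrite /lebesgue_cons /pushforward; exact: measure_ge0. Qed.

Let preim_measurable (A : set (n.+1.-tuple B)) :
  measurable A -> measurable (@tuple_cons n @^-1` A).
Proof. by move=> mA; rewrite -[X in measurable X]setTI; exact: measurable_tuple_cons. Qed.

Let lebesgue_cons_sigma_additive : semi_sigma_additive lebesgue_cons.
Proof.
move=> F mF tF mUF; rewrite /lebesgue_cons /pushforward preimage_bigcup.
apply: (measure_semi_sigma_additive (fun i => @tuple_cons n @^-1` F i)).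
- by move=> i; exact: preim_measurable.
- apply/trivIsetP => /= i j _ _ ij; rewrite -preimage_setI.
  by move/trivIsetP : tF => /(_ _ _ _ _ ij) ->//; rewrite preimage_set0.
- by rewrite -preimage_bigcup; exact: preim_measurable.
Qed.

HB.instance Definition _ := isMeasure.Build _ _ _ lebesgue_cons
  lebesgue_cons0 lebesgue_cons_ge0 lebesgue_cons_sigma_additive.

Let lebesgue_cons_sigma_finite : sigma_finite setT lebesgue_cons.
Proof.
have /sigma_finiteP[F [TF ndF Foo]] := sigma_finiteT (@lebesgue_measure R).
have /sigma_finiteP[G [TG ndG Goo]] := sigma_finiteT mu.
pose uncons (x : n.+1.-tuple B) : B * n.-tuple B := (thead x, [tuple of behead x]).
have consK : cancel (@tuple_cons n) uncons.
  move=> [a t]; rewrite /uncons /tuple_cons/= theadE; congr pair.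
  exact/val_inj.
have unconsK : cancel uncons (@tuple_cons n).
  by move=> x; rewrite /uncons /tuple_cons/= [RHS]tuple_eta.
have muncons : measurable_fun setT uncons.
  apply/measurable_fun_pairP; split => /=.
    exact: (measurable_tnth ord0).
  exact: measurable_behead.
exists (fun k => uncons @^-1` (F k `*` G k)).
  rewrite -preimage_bigcup (_ : \bigcup_k _ = setT) ?preimage_setT//.
  apply/seteqP; split=> // -[a t] _.
  have [k _ Fka] : (\bigcup_k F k) a by rewrite -TF.
  have [l _ Glt] : (\bigcup_k G k) t by rewrite -TG.
  exists (maxn k l) => //; split => /=.
    by move: a Fka; exact/subsetPset/ndF/leq_maxl.
  by move: t Glt; exact/subsetPset/ndG/leq_maxr.
move=> k; have [mF Fk] := Foo k; have [mG Gk] := Goo k; split.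
  by rewrite -[X in measurable X]setTI; apply: muncons => //; exact: measurableX.
rewrite /lebesgue_cons /pushforward -comp_preimage.
rewrite (_ : _ \o _ = id); last by apply/funext => z /=; rewrite consK.
by rewrite preimage_id product_measure1E// lte_mul_pinfty// ge0_fin_numE.
Qed.

HB.instance Definition _ :=
  Measure_isSigmaFinite.Build _ _ _ lebesgue_cons lebesgue_cons_sigma_finite.

End step.

(* n-dimensional Lebesgue measure on Borel sets: the n-fold product of
   one-dimensional Lebesgue measure *)
Fixpoint lebesgue_tuple n : {sigma_finite_measure set (n.-tuple B) -> \bar R} :=
  match n with
  | 0 => @dirac _ (0.-tuple B) [tuple] R
  | n'.+1 => lebesgue_cons (lebesgue_tuple n')
  end.

End tuple_lebesgue_measure.
Arguments lebesgue_tuple : clear implicits.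

Section parabolic.
Context {R : realType} {n : nat}.

(* R^n x R with the Lebesgue sigma-algebra, i.e. the Caratheodory-measurable
   sets of Lebesgue outer measure; lebesgue_spacetime is Lebesgue measure on it *)
Definition spacetime : Type :=
  caratheodory_type ((lebesgue_tuple R n \x @lebesgue_measure R)%E^*)%mu.

HB.instance Definition _ := Measurable.on spacetime.

Definition lebesgue_spacetime : set spacetime -> \bar R :=
  @completed_measure_extension _ _ _ (lebesgue_tuple R n \x @lebesgue_measure R)%E.

HB.instance Definition _ := Measure.on lebesgue_spacetime.

Definition cube (x : n.-tuple R) (L : R) : set (n.-tuple R) :=
  [set y | forall i, `|tnth y i - tnth x i| <= L].

Definition prect (p : R) (x : n.-tuple R) (t L : R) : set spacetime :=
  cube x L `*` `]t - L `^ p, t + L `^ p[%classic.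

Definition prect_upper (p gamma : R) (x : n.-tuple R) (t L : R) :
    set spacetime :=
  cube x L `*` `]t + gamma * L `^ p, t + L `^ p[%classic.

Definition prect_lower (p gamma : R) (x : n.-tuple R) (t L : R) :
    set spacetime :=
  cube x L `*` `]t - L `^ p, t - gamma * L `^ p[%classic.

(* Takes the value +oo when the set of admissible levels is empty. *)
Definition max_median (s : R) (E : set spacetime) (g : spacetime -> \bar R) :
    \bar R :=
  ereal_inf [set a%:E | a in [set a : R |
    (lebesgue_spacetime (E `&` [set z | (a%:E < g z)%E]) <
       s%:E * lebesgue_spacetime E)%E]].

Definition recentered (f : spacetime -> \bar R) (c : R) : spacetime -> \bar R :=
  fun z => (f z - c%:E)%E.

Definition median_oscillation (p gamma s : R) (f : spacetime -> \bar R)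
    (x : n.-tuple R) (t L : R) : \bar R :=
  ereal_inf [set (max_median s (prect_upper p gamma x t L) (recentered f c)^\+ +
                  max_median s (prect_lower p gamma x t L) (recentered f c)^\-)%E
            | c in [set: R]].

(* U is the ambient parabolic rectangle, given as a set. *)
Definition pbmo_norm (p gamma s : R) (U : set spacetime)
    (f : spacetime -> \bar R) : \bar R :=
  ereal_sup [set m | exists (x : n.-tuple R) (t L : R),
    [/\ 0 < L, prect p x t L `<=` U & m = median_oscillation p gamma s f x t L]].

(* A function on U is represented by a total function, whose values outside
   U are never used. *)
Definition pbmo (p gamma s : R) (U : set spacetime) :
    set (spacetime -> \bar R) :=
  [set f : spacetime -> \bar R | measurable_fun U f /\ (pbmo_norm p gamma s U f < +oo)%E].

End parabolic.
Arguments spacetime : clear implicits.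

(* Main.v *)
Require Import Defs.
From HB Require Import structures.
From mathcomp Require Import all_boot all_order all_algebra.
From mathcomp Require Import all_classical all_reals all_analysis.
From mathcomp Require Import measurable_realfun ring lra.

(* The medians yield, for w = 2 |f| and every parabolic rectangle P in R, a real
   c_P such that f > c_P + w on at most the fraction s of P^+(gamma) and
   f < c_P - w on at most the fraction s of P^-(gamma).  Subdivide R^+(alpha)
   into nested grids of cells S, each with a rectangle P_S over the same cube and
   with the same top as S.  The cells of the next level are so flat that
   P_{S'} lies in P_S^+(gamma) for every cell S' strictly inside S.

   Fix S and stop at the first S' inside S with c_{S'} > c_S + 2w.
   - On most of P_{S'}^- one has f > c_S + w, while this happens on at most the
     fraction s of P_S^+(gamma).  So some cell S* among a bounded number of cells
     below S' meets {f > c_S + w} in a fixed fraction.  The maximal cells S* are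
     disjoint, and the S' are covered by bounded upward dilations of them: for
     small s the stopped cells fill at most the fraction 1/e of S.
   - The same comparison with the parent of S' gives c_{S'} <= c_S + 4w.
   - Off the stopped cells f <= c_S + 3w almost everywhere, by density.
   Iterating, |S and {f > c_S + 4kw}| <= e^-k |S|.  The lower part is the same
   statement for -f with time reversed. *)

Set Implicit Arguments.
Unset Strict Implicit.
Unset Printing Implicit Defensive.

Import Order.TTheory GRing.Theory Num.Theory.
Import numFieldNormedType.Exports.

Local Open Scope classical_set_scope.
Local Open Scope ring_scope.

(** * Level sets of a function measurable on a domain *)

Section level_sets.
Context d (X : measurableType d) (R : realType) (U : set X) (f : X -> \bar R).
Hypotheses (mU : measurable U) (mf : measurable_fun U f).

Lemma superlevel_measurable (A : set X) (a : \bar R) : measurable A -> A `<=` U ->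
  measurable (A `&` [set z | (a < f z)%E]).
Proof.
move=> mA AU; rewrite -(setIidl AU) -setIA; apply: measurableI => //.
exact: emeasurable_fun_o_infty.
Qed.

Lemma sublevel_measurable (A : set X) (a : \bar R) : measurable A -> A `<=` U ->
  measurable (A `&` [set z | (f z < a)%E]).
Proof.
move=> mA AU; rewrite -(setIidl AU) -setIA; apply: measurableI => //.
exact: emeasurable_fun_infty_o.
Qed.

End level_sets.

(** * Unions over countable index types *)

Section countable_unions.
Context d (X : measurableType d) (R : realType) (mu : {measure set X -> \bar R}).

Lemma bigcup_count_measurable (T : countType) (P : set T) (A : T -> set X) :
  (forall t, P t -> measurable (A t)) -> measurable (\bigcup_(t in P) A t).
Proof.
move=> mA; rewrite bigcup_mkcond; apply: countable_bigcupT_measurable.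
  exact: countableP.
by move=> t; case: ifPn => // /set_mem; exact: mA.
Qed.

(** The [A t] may overlap: subadditivity gives at most [C] times the sum of the [mu (B t)], and that
    sum is the measure of a disjoint union inside [G]. *)
Lemma measure_bigcup_le (T : countType) (P : set T) (A B : T -> set X)
    (G : set X) (C : R) :
  (forall t, P t -> measurable (A t)) -> (forall t, P t -> measurable (B t)) ->
  trivIset P B -> (forall t, P t -> B t `<=` G) -> measurable G ->
  0 <= C -> (forall t, P t -> (mu (A t) <= C%:E * mu (B t))%E) ->
  (mu (\bigcup_(t in P) A t) <= C%:E * mu G)%E.
Proof.
move=> mA mB tB BG mG C0 AB.
(* Reindexes the family by naturals, padding with the empty set, so that series over [nat] apply. *)
pose lift (F : T -> set X) (n : nat) :=
  if pickle_inv n is Some t then (if t \in P then F t else set0) else set0.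
have liftE F : \bigcup_(t in P) F t = \bigcup_n lift F n.
  apply/seteqP; split => [x [t Pt Fx]|x [n _]].
    by exists (pickle t) => //; rewrite /lift pickleK_inv mem_set.
  by rewrite /lift; case: pickle_inv => // t; case: ifPn => // /set_mem Pt Fx; exists t.
have mlift F : (forall t, P t -> measurable (F t)) -> forall n, measurable (lift F n).
  by move=> mF n; rewrite /lift; case: pickle_inv => // t; case: ifPn => // /set_mem/mF.
have tlift : trivIset setT (lift B).
  apply/trivIsetP => i j _ _ ij; rewrite /lift.
  case ti : (pickle_inv i) => [t|]; last by rewrite set0I.
  case tj : (pickle_inv j) => [u|]; last by rewrite setI0.
  case: ifPn => [/set_mem Pt|_]; last by rewrite set0I.
  case: ifPn => [/set_mem Pu|_]; last by rewrite setI0.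
  move/trivIsetP : tB; apply => //; apply: contra ij => /eqP tu.
  have := pickle_invK (T := T) i; have := pickle_invK (T := T) j.
  by rewrite /ocancel ti tj /= tu => -> ->.
rewrite liftE.
apply: (@le_trans _ _ (\sum_(0 <= n <oo) mu (lift A n))%E).
  apply: measure_sigma_subadditive => //; first exact: mlift.
  by rewrite -liftE; exact: bigcup_count_measurable.
apply: (@le_trans _ _ (\sum_(0 <= n <oo) C%:E * mu (lift B n))%E).
  apply: lee_nneseries => // n _; rewrite /lift; case: pickle_inv => [t|].
    by case: ifPn => [/set_mem/AB//|]; rewrite !measure0 mule0.
  by rewrite !measure0 mule0.
rewrite nneseriesZl//; apply: lee_wpmul2l; first by rewrite lee_fin.
rewrite -measure_semi_bigcup//.
- apply: le_measure; rewrite ?inE//.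
    by apply: bigcupT_measurable; exact: mlift.
  by rewrite -liftE => x [t Pt Bx]; exact: (BG t).
- exact: mlift.
- by apply: bigcupT_measurable; exact: mlift.
Qed.

End countable_unions.

(** * Nested partitions and their maximal cells *)

Section nested_partitions.
Context (X : Type) (I : countType) (idx : nat -> X -> I).

(** A partition is given by its labelling [idx k]; its cells are the fibres, so they are disjoint
    and cover by construction. *)
Definition cell k i : set X := [set x | idx k x = i].

Hypothesis idx_nested :
  forall k x y, idx k.+1 x = idx k.+1 y -> idx k x = idx k y.

Lemma idx_nested_le j k x y : (j <= k)%N -> idx k x = idx k y -> idx j x = idx j y.
Proof.
move=> /subnK <-; elim: (k - j)%N => // m IH.
by rewrite addSn => /idx_nested.
Qed.

(** The maximal cells with property [b] among those of level at least [k0]; the witness [x] names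
    the coarser cells containing the given one. *)
Definition first_cells (k0 : nat) (b : nat -> I -> Prop) : set (nat * I) :=
  [set t | exists x, [/\ idx t.1 x = t.2, (k0 <= t.1)%N, b t.1 t.2 &
    forall j, (k0 <= j < t.1)%N -> ~ b j (idx j x)]].

(** If two of them share a point, the coarser one contains the finer one and contradicts its
    maximality. *)
Lemma first_cells_trivIset k0 b :
  trivIset (first_cells k0 b) (fun t => cell t.1 t.2).
Proof.
move=> [k i] [k' i'] [x /= [xi kk bk fk]] [x' /= [xi' kk' bk' fk']] [y [/= yi yi']].
have [ltk|ltk|ek] := ltngtP k k'.
- exfalso; apply: (fk' k); first by rewrite kk ltk.
  by rewrite (idx_nested_le (ltnW ltk) (etrans xi' (esym yi'))) yi.
- exfalso; apply: (fk k'); first by rewrite kk' ltk.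
  by rewrite (idx_nested_le (ltnW ltk) (etrans xi (esym yi))) yi'.
- by move: yi'; rewrite -ek /cell/= yi => ->.
Qed.

Lemma first_cells_ex k0 (b : nat -> I -> Prop) k x :
  (k0 <= k)%N -> b k (idx k x) ->
  exists2 j, (k0 <= j <= k)%N & first_cells k0 b (j, idx j x).
Proof.
move=> k0k bk; pose P j := (k0 <= j)%N && `[< b j (idx j x) >].
have exP : exists j, P j by exists k; rewrite /P k0k; apply/asboolP.
case: (ex_minnP exP) => j /andP[k0j /asboolP bj] minj; exists j.
  by rewrite k0j minj// /P k0k; apply/asboolP.
exists x; split => // l /andP[k0l lj] bl.
have := minj l; rewrite /P k0l/= => /(_ (introT (asboolP _) bl)).
by rewrite leqNgt lj.
Qed.

End nested_partitions.

(** * The stopping-time argument on abstract nested cells *)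

(* Cells of level k have measure m k; Pp and Pm stand for the upper and lower
   parts, of measure v k, of the rectangle attached to a cell, D for an upward
   dilation of a cell, and below k i j for the j-th cell below the cell (k, i). *)
Section stopping_time.
Context d (X : measurableType d) (R : realType) (mu : {measure set X -> \bar R}).
Context (I : countType) (idx : nat -> X -> I) (i0 : I).
Local Notation cell := (cell idx).
Local Notation S0 := (cell 0%N i0).

Hypothesis idx_nested :
  forall k x y, idx k.+1 x = idx k.+1 y -> idx k x = idx k y.

Variables (m v : nat -> R) (K0 K1 KD q s w : R) (J : nat).
Hypothesis m_gt0 : forall k, 0 < m k.
Hypothesis mcell : forall k i, measurable (cell k i).
Hypothesis mu_cell : forall k i, mu (cell k i) = (m k)%:E.
(** Stands in for the Lebesgue density theorem. *)
Hypothesis null_criterion : forall (E : set X) (theta : R) k,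
  measurable E -> E `<=` S0 -> 0 <= theta < 1 ->
  (forall k' i, (k <= k')%N -> (mu (E `&` cell k' i) <= (theta * m k')%:E)%E) ->
  mu E = 0%E.

Variable D : nat -> I -> set X.
Hypothesis mD : forall k i, measurable (D k i).
Hypothesis mu_D : forall k i, (mu (D k i) <= (KD * m k)%:E)%E.
Hypothesis D_nested : forall k x, D k.+1 (idx k.+1 x) `<=` D k (idx k x).

Variables (U : set X) (Pp Pm : nat -> I -> set X).
Hypothesis mU : measurable U.
Hypothesis mPp : forall k i, measurable (Pp k i).
Hypothesis mPm : forall k i, measurable (Pm k i).
Hypothesis mu_Pp : forall k i, mu (Pp k i) = (v k)%:E.
Hypothesis mu_Pm : forall k i, mu (Pm k i) = (v k)%:E.
Hypothesis PpU : forall k x, S0 x -> Pp k (idx k x) `<=` U.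
Hypothesis PmU : forall k x, S0 x -> Pm k (idx k x) `<=` U.
Hypothesis cell_Pp : forall k i, cell k i `<=` Pp k i.
Hypothesis Pm_Pp : forall k k' x, (k < k')%N ->
  Pm k' (idx k' x) `<=` Pp k (idx k x).
Hypothesis vK0 : forall k, v k <= K0 * m k.
Hypothesis vK1 : forall k, v k <= K1 * v k.+1.

Variable below : nat -> I -> 'I_J -> I.
Hypothesis Pm_below : forall k i, Pm k i `<=` \bigcup_j cell k (below k i j).
Hypothesis cell_D : forall k i j, cell k i `<=` D k (below k i j).

Hypothesis J_gt0 : (0 < J)%N.
Hypothesis KD_ge0 : 0 <= KD.
Hypothesis s_gt0 : 0 < s.
Hypothesis s_le : s <= 2^-1.
Hypothesis sK0 : s * K0 < 1.
Hypothesis sK1 : s * K1 < 2^-1.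
Hypothesis sq : KD * (2 * J%:R) * (s * K0) <= q.

Variables (f : X -> \bar R) (c : nat -> I -> R).
Hypothesis mf : measurable_fun U f.
Hypothesis w_gt0 : 0 < w.
Hypothesis hup : forall k x, S0 x ->
  (mu (Pp k (idx k x) `&` [set z | ((c k (idx k x) + w)%:E < f z)%E]) <=
     (s * v k)%:E)%E.
Hypothesis hlow : forall k x, S0 x ->
  (mu (Pm k (idx k x) `&` [set z | (f z < (c k (idx k x) - w)%:E)%E]) <=
     (s * v k)%:E)%E.

Let v_ge k : m k <= v k.
Proof.
have [x _] : cell k (idx k point) !=set0 by exists point.
rewrite -lee_fin -(mu_cell k (idx k point)) -(mu_Pp k (idx k point)).
by apply: le_measure; rewrite ?inE.
Qed.

Let v_gt0 k : 0 < v k. Proof. exact: lt_le_trans (m_gt0 k) (v_ge k). Qed.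

Let K0_ge0 : 0 <= K0.
Proof. by rewrite -(pmulr_lge0 _ (m_gt0 0)) (le_trans _ (vK0 0))// ltW. Qed.

Let cell_sub j k x y : (j <= k)%N -> cell k (idx k x) y -> cell j (idx j x) y.
Proof. by move=> jk; exact: (idx_nested_le idx_nested). Qed.

Let mgt := superlevel_measurable mU mf.
Let mlt := sublevel_measurable mU mf.

Let G k i := Pp k i `&` [set z | ((c k i + w)%:E < f z)%E].

Let mG k x : S0 x -> measurable (G k (idx k x)).
Proof. by move=> Sx; apply: mgt => //; exact: PpU. Qed.

(** Off a fraction [s], at most 1/2, of the finer lower part, [f] is at least [c k' _ - w], which
    exceeds [c k _ + w]; and that lower part lies in [Pp k _]. *)
Let Pm_half k k' x : S0 x -> (k < k')%N ->
  c k (idx k x) + 2 * w < c k' (idx k' x) ->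
  ((2^-1 * v k')%:E <= mu (Pm k' (idx k' x) `&` G k (idx k x)))%E.
Proof.
move=> Sx kk' hc.
set A := (X in mu X); set B := Pm k' (idx k' x) `&`
  [set z | (f z < (c k' (idx k' x) - w)%:E)%E].
have mA : measurable A by apply: measurableI => //; exact: mG.
have mB : measurable B by apply: mlt => //; exact: PmU.
have : (mu (Pm k' (idx k' x)) <= mu A + mu B)%E.
  apply: le_trans (measureU2 _ mA mB); apply: le_measure; rewrite ?inE//.
    exact: measurableU.
  move=> z Pz; have [fz|fz] := ltP (f z) (c k' (idx k' x) - w)%:E.
    by right.
  left; split => //; split; first exact: (Pm_Pp kk').
  by apply: lt_le_trans fz; rewrite lte_fin; lra.
move=> /le_trans/(_ (leeD (lexx _) (hlow k' Sx))).
rewrite mu_Pm -leeBlDr// -EFinB; apply: le_trans.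
rewrite lee_fin; have : 0 <= (2^-1 - s) * v k'.
  by rewrite mulr_ge0 ?subr_ge0// ltW.
by lra.
Qed.

(** A larger jump would put half of the child's lower part into [G k _], whose measure is at most
    [s * v k], hence at most [s * K1 * v k.+1], less than half of [v k.+1]. *)
Let c_jump k x : S0 x -> c k.+1 (idx k.+1 x) <= c k (idx k x) + 2 * w.
Proof.
move=> Sx; rewrite leNgt; apply/negP => /(Pm_half Sx (ltnSn k)).
move=> /le_trans/(_ (_ : (_ <= mu (G k (idx k x)))%E)).
have GP : (mu (Pm k.+1 (idx k.+1 x) `&` G k (idx k x)) <= mu (G k (idx k x)))%E.
  by apply: measureIr => //; exact: mG.
move=> /(_ GP)/le_trans/(_ (hup k Sx)); rewrite lee_fin.
have sv : s * v k <= s * (K1 * v k.+1) by rewrite ler_wpM2l// ltW.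
have : 0 < (2^-1 - s * K1) * v k.+1 by rewrite mulr_gt0 ?subr_gt0.
by lra.
Qed.

Let stopped k x : set (nat * I) := [set t |
  first_cells idx k.+1 (fun k' i' => c k (idx k x) + 2 * w < c k' i') t /\
  cell t.1 t.2 `<=` cell k (idx k x)].

Let Z k x := \bigcup_(t in stopped k x) cell t.1 t.2.

Let cell_S0 k x y : S0 x -> cell k (idx k x) y -> S0 y.
Proof. by move=> Sx /(cell_sub (leq0n k)); rewrite /cell/= => ->. Qed.

(** The parent of a stopped cell is the starting cell or was not stopped, so its constant exceeds
    the starting one by at most [2 * w]; [c_jump] adds another [2 * w]. *)
Let stopped_c k x t : S0 x -> stopped k x t ->
  exists y, [/\ S0 y, idx t.1 y = t.2 & c t.1 t.2 <= c k (idx k x) + 4 * w].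
Proof.
case: t => k' i' Sx [[y /= [yi kk' bk fk]] sub]; exists y.
have ykx : cell k (idx k x) y by exact: sub.
have Sy : S0 y := cell_S0 Sx ykx.
split=> //; case: k' yi kk' bk fk sub => // k' yi kk' bk fk sub.
have := c_jump k' Sy; rewrite yi.
have : c k' (idx k' y) <= c k (idx k x) + 2 * w.
  have [<-|nkk'] := eqVneq k k'; first by rewrite ykx lerDl mulr_ge0// ltW.
  by rewrite leNgt; apply/negP/fk; rewrite ltn_neqAle nkk' -ltnS kk' ltnSn.
by lra.
Qed.

Let mZ k x : measurable (Z k x).
Proof. by apply: bigcup_count_measurable. Qed.

Let D_sub j k x : (j <= k)%N -> D k (idx k x) `<=` D j (idx j x).
Proof.
move=> /subnK <-; elim: (k - j)%N => // n IH.
by rewrite addSn; apply: subset_trans IH; exact: D_nested.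
Qed.

Let cell_ex k i : exists y, idx k y = i.
Proof.
have : cell k i !=set0.
  apply/set0P/negP => /eqP c0; have := mu_cell k i; rewrite c0 measure0.
  by move=> [m0]; have := m_gt0 k; rewrite -m0 ltxx.
by case=> y; exists y.
Qed.

(** Pigeonhole: the [J] cells below cover the lower part, half of which lies in [G k _], and [v k']
    is at least [m k']. *)
Let below_half k k' x : S0 x -> (k < k')%N ->
  c k (idx k x) + 2 * w < c k' (idx k' x) -> exists j,
  ((m k')%:E <= (2 * J%:R)%:E *
     mu (G k (idx k x) `&` cell k' (below k' (idx k' x) j)))%E.
Proof.
move=> Sx kk' hc; apply: contrapT => /forallNP hj.
have := Pm_half Sx kk' hc; apply/negP; rewrite -ltNge.
have hlt j : (mu (G k (idx k x) `&` cell k' (below k' (idx k' x) j)) <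
    (m k' / (2 * J%:R))%:E)%E.
  have J0 : 0 < 2 * J%:R :> R by rewrite mulr_gt0// ltr0n.
  by rewrite mulrC EFinM lte_pdivlMl// ltNge; exact/negP/hj.
set B := fun j => G k (idx k x) `&` cell k' (below k' (idx k' x) j).
have mB j : measurable (B j) by apply: measurableI => //; exact: mG.
apply: (@le_lt_trans _ _ (\sum_(j < J) mu (B j))%E).
  (* Extends the family from ['I_J] to [nat] by the empty set. *)
  pose B' (n : nat) := if insub n is Some j then B j else set0.
  have mB' n : measurable (B' n) by rewrite /B'; case: insubP.
  rewrite (eq_bigr (fun j : 'I_J => mu (B' j))); last first.
    by move=> j _; rewrite /B' valK.
  apply: (content_subadditive mu) => //.
    by apply: measurableI => //; exact: mG.
  move=> z [Pz Gz]; have [j _ cz] := Pm_below Pz.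
  by rewrite -bigcup_mkord; exists (val j) => //=; rewrite /B' valK.
apply: (@lt_le_trans _ _ (\sum_(j < J) (m k' / (2 * J%:R))%:E)%E).
  rewrite (bigD1 (Ordinal J_gt0))//= [ltRHS](bigD1 (Ordinal J_gt0))//=.
  apply: lte_leD; [|exact: hlt|by apply: lee_sum => i _; exact/ltW/hlt].
  rewrite ge0_fin_numE; last exact: sume_ge0.
  by apply: lte_sum_pinfty => j _; apply: lt_le_trans (hlt j) (leey _).
rewrite sumEFin lee_fin sumr_const card_ord -[leLHS]mulr_natr.
have J0 : J%:R != 0 :> R by rewrite pnatr_eq0 -lt0n.
rewrite (_ : m k' / (2 * J%:R) * J%:R = 2^-1 * m k'); last by field.
by rewrite ler_pM2l// v_ge.
Qed.

(** A stopped cell need not meet [G] itself, so the covering uses the maximal cells in which [G] has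
    density at least [1 / (2 * J)]. They are disjoint, so the sum of their measures is at most
    [2 * J] times that of [G], and passing to the dilations costs the factor [KD]. They may leave
    the starting cell, since [G] lives in the whole of [Pp]. *)
Let muZ k x : S0 x -> (mu (Z k x) <= (q * m k)%:E)%E.
Proof.
move=> Sx.
pose b k' i' := ((m k')%:E <= (2 * J%:R)%:E * mu (G k (idx k x) `&` cell k' i'))%E.
pose P := first_cells idx k.+1 b.
have J0 : 0 <= 2 * J%:R :> R by [].
(* A dense cell below a stopped cell lies in some maximal dense cell of level [l <= k']; by nesting,
   the dilation of the latter contains that of the former, which contains the stopped cell. *)
have ZD : Z k x `<=` \bigcup_(t in P) D t.1 t.2.
  move=> y [[k' i'] [[x' [/= x'i kk' bk' _]] sub] yi].
  have yi' : idx k' y = i' by [].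
  have Sy : S0 y by apply: cell_S0 (sub _ yi).
  have ykx : idx k y = idx k x by exact: (sub _ yi).
  have [|j bj] := below_half (k := k) Sy kk'; first by rewrite ykx yi'.
  have [z zj] := cell_ex k' (below k' (idx k' y) j).
  have [|l /andP[kl lk'] Pl] :=
    @first_cells_ex _ _ idx k.+1 b k' z kk'; first by rewrite /b zj -ykx.
  exists (l, idx l z) => //=; apply: (D_sub lk'); rewrite zj.
  exact: cell_D.
have mDP : measurable (\bigcup_(t in P) D t.1 t.2) by exact: bigcup_count_measurable.
apply: (@le_trans _ _ (mu (\bigcup_(t in P) D t.1 t.2))).
  by apply: le_measure; rewrite ?inE.
apply: (@le_trans _ _ ((KD * (2 * J%:R))%:E * mu (G k (idx k x)))%E).
  apply: (measure_bigcup_le (P := P)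
    (B := fun t => G k (idx k x) `&` cell t.1 t.2)) => //.
  - by move=> t _; apply: measurableI => //; exact: mG.
  - move=> t u Pt Pu [z [[_ tz] [_ uz]]].
    by apply: (first_cells_trivIset idx_nested Pt Pu); exists z.
  - exact: mG.
  - exact: mulr_ge0.
  - move=> [k' i'] [y [_ _ bt _]] /=; apply: le_trans (mu_D k' i') _.
    by rewrite !EFinM -muleA; apply: lee_wpmul2l => //; rewrite -EFinM.
apply: (@le_trans _ _ ((KD * (2 * J%:R))%:E * (s * v k)%:E)%E).
  by apply: lee_wpmul2l; [rewrite lee_fin mulr_ge0|exact: hup].
rewrite -EFinM lee_fin.
apply: (@le_trans _ _ (KD * (2 * J%:R) * (s * K0) * m k)).
  by rewrite -mulrA ler_wpM2l ?mulr_ge0// -mulrA ler_wpM2l// ltW.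
by rewrite ler_wpM2r// ltW.
Qed.

(** A finer cell meeting the exceptional set is not stopped, so its constant is at most
    [c k _ + 2 * w]. There [f > c k _ + 3 * w] forces [f] above the cell's own constant plus [w],
    which leaves density at most [s * K0 < 1] at every finer level. *)
Let off_Z k x : S0 x ->
  mu ((cell k (idx k x) `\` Z k x) `&`
        [set z | ((c k (idx k x) + 3 * w)%:E < f z)%E]) = 0%E.
Proof.
move=> Sx; set E := _ `&` _.
have ESk : E `<=` cell k (idx k x) by move=> y [[]].
have SkU : cell k (idx k x) `<=` U.
  by apply: subset_trans (PpU (k := k) Sx); exact: cell_Pp.
have mE : measurable E.
  by apply: mgt; [exact: measurableD | exact: subset_trans (@subDsetl _ _ _) SkU].
apply: (null_criterion (theta := s * K0) (k := k) mE).
- by move=> y /ESk; exact: cell_S0.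
- by rewrite sK0 andbT mulr_ge0// ltW.
move=> k' i' kk'.
have s0 := ltW s_gt0.
have [->|/set0P[y [Ey yi]]] := eqVneq (E `&` cell k' i') set0.
  rewrite measure0 lee_fin -mulrA mulr_ge0//.
  by apply: le_trans (vK0 k'); exact/ltW/v_gt0.
have Sy : S0 y by exact: cell_S0 (ESk _ Ey).
have yi' : idx k' y = i' by [].
have ykx : idx k y = idx k x by exact: (ESk _ Ey).
have hc : c k' i' <= c k (idx k x) + 2 * w.
  have [ekk'|nkk'] := eqVneq k k'.
    by rewrite -yi' -ekk' ykx; have := w_gt0; lra.
  rewrite leNgt; apply/negP => hlt.
  have [||j /andP[kj jk'] Pj] := @first_cells_ex _ _ idx k.+1
      (fun k' i' => c k (idx k x) + 2 * w < c k' i') k' y.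
  - by rewrite ltn_neqAle nkk'.
  - by rewrite yi'.
  - have [[_ nZ] _] := Ey; apply: nZ; exists (j, idx j y) => //; split => //=.
    by move=> z /(cell_sub (ltnW kj)); rewrite ykx.
apply: (@le_trans _ _ (s * v k')%:E); last first.
  by rewrite lee_fin -mulrA ler_wpM2l.
apply: le_trans (hup k' Sy); apply: le_measure; rewrite ?inE.
- exact: measurableI.
- exact: mG.
- move=> z [[_ fz] zi]; split; first by rewrite yi'; exact: cell_Pp.
  by apply: le_lt_trans fz; rewrite lee_fin yi'; lra.
Qed.

(** Induction on [n]: outside [Z] the superlevel set is null, and inside each stopped cell the
    induction hypothesis applies, since its constant has grown by at most [4 * w]. Summing over the
    stopped cells gives [q ^+ n * mu Z], and [muZ] supplies the last factor [q]. *)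
Lemma stopping_time_decay n k x : S0 x ->
  (mu (cell k (idx k x) `&`
        [set z | ((c k (idx k x) + 4 * w * n%:R)%:E < f z)%E]) <=
     (q ^+ n * m k)%:E)%E.
Proof.
have q0 : 0 <= q.
  by apply: le_trans sq; rewrite mulr_ge0 ?mulr_ge0// ltW.
elim: n k x => [|n IH] k x Sx; rewrite ?mulr0 ?addr0 ?expr0 ?mul1r.
all: have SkU : cell k (idx k x) `<=` U
  by apply: subset_trans (PpU (k := k) Sx); exact: cell_Pp.
  rewrite -(mu_cell k (idx k x)).
  by apply: le_measure; rewrite ?inE//; exact: mgt.
set E := _ `&` _.
have mE : measurable E by exact: mgt.
pose E1 := (cell k (idx k x) `\` Z k x) `&`
        [set z | ((c k (idx k x) + 3 * w)%:E < f z)%E].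
pose E2 := \bigcup_(t in stopped k x) (cell t.1 t.2 `&`
        [set z | ((c k (idx k x) + 4 * w * n.+1%:R)%:E < f z)%E]).
have tU t : stopped k x t -> cell t.1 t.2 `<=` U.
  by move=> [_ sub]; exact: subset_trans sub SkU.
have mE1 : measurable E1.
  by apply: mgt; [exact: measurableD | exact: subset_trans (@subDsetl _ _ _) SkU].
have mE2 : measurable E2.
  by apply: bigcup_count_measurable => t Pt; apply: mgt => //; exact: tU.
have EE : E `<=` E1 `|` E2.
  move=> y [yx fy]; have [[t Pt yt]|nZ] := pselect (Z k x y).
    by right; exists t.
  left; split => //; apply: le_lt_trans fy; rewrite lee_fin lerD2l.
  by rewrite -natr1; have : 0 <= n%:R :> R by []; have := w_gt0; nra.
apply: (@le_trans _ _ (mu E1 + mu E2)%E).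
  apply: le_trans (measureU2 _ mE1 mE2); apply: le_measure; rewrite ?inE//.
  exact: measurableU.
rewrite /E1 off_Z// add0e.
apply: (@le_trans _ _ ((q ^+ n)%:E * mu (Z k x))%E); last first.
  rewrite exprSr -mulrA EFinM; apply: lee_wpmul2l; last exact: muZ.
  by rewrite lee_fin exprn_ge0.
apply: (measure_bigcup_le (B := fun t => cell t.1 t.2)) => //.
- by move=> t Pt; apply: mgt => //; exact: tU.
- move=> t u [Pt _] [Pu _]; exact: (first_cells_trivIset idx_nested Pt Pu).
- by move=> t Pt y ty; exists t.
- exact: exprn_ge0.
- move=> t Pt; have [y [Sy yt ct]] := stopped_c Sx Pt.
  rewrite mu_cell -EFinM; apply: le_trans (IH t.1 y Sy).
  rewrite yt; apply: le_measure; rewrite ?inE.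
  + by apply: mgt => //; exact: tU.
  + by apply: mgt => //; exact: tU.
  + move=> z [zt fz]; split => //; apply: le_lt_trans fz; rewrite lee_fin.
    by rewrite -natr1; lra.
Qed.

End stopping_time.

(** * A density criterion through approximation by unions of cells *)

Section density.
Context d (X : measurableType d) (R : realType) (mu : {measure set X -> \bar R}).
Context (I : countType) (idx : nat -> X -> I) (i0 : I).
Local Notation cell := (cell idx).
Local Notation S0 := (cell 0%N i0).

Hypothesis idx_nested :
  forall k x y, idx k.+1 x = idx k.+1 y -> idx k x = idx k y.
Hypothesis mcell : forall k i, measurable (cell k i).
Hypothesis mu_S0 : (mu S0 < +oo)%E.

Lemma preimage_idx_measurable k (Q : set I) : measurable (idx k @^-1` Q).
Proof.
rewrite (_ : _ @^-1` _ = \bigcup_(i in Q) cell k i).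
  exact: bigcup_count_measurable.
by apply/seteqP; split => [x Qx|x [i Qi xi]];
  [exists (idx k x)|rewrite /preimage/= xi].
Qed.

Lemma preimage_idx_refine j k (Q : set I) : (j <= k)%N ->
  exists Q' : set I, idx j @^-1` Q = idx k @^-1` Q'.
Proof.
move=> jk; exists (idx k @` (idx j @^-1` Q)); apply/seteqP; split => [x Qx|x [y Qy]].
  by exists x.
by move=> /(idx_nested_le idx_nested jk); rewrite /preimage/= => <-.
Qed.

(** Approximation in measure inside [S0] by a union of cells of one level. That level can be taken
    beyond any [k], because the density bound is assumed only from some level on. *)
Definition approximable (E : set X) := measurable E /\
  forall k (e : R), 0 < e -> exists K (Q : set I), [/\ (k <= K)%N,
    (mu (S0 `&` (E `\` idx K @^-1` Q)) <= e%:E)%E &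
    (mu (S0 `&` ((idx K @^-1` Q) `\` E)) <= e%:E)%E].

Local Hint Resolve preimage_idx_measurable : core.

Lemma approximable_preimage_idx k (Q : set I) : approximable (idx k @^-1` Q).
Proof.
split=> // k' e e0; exists (maxn k k').
have [Q' ->] := preimage_idx_refine Q (leq_maxl k k').
by exists Q'; rewrite leq_maxr setDv setI0 measure0 lee_fin ltW.
Qed.

Lemma approximableC E : approximable E -> approximable (~` E).
Proof.
move=> [mE aE]; split; first exact: measurableC.
move=> k e e0; have [K [Q [kK h1 h2]]] := aE k e e0; exists K, (~` Q).
by rewrite preimage_setC !setDE !setCK [~` E `&` _]setIC [~` _ `&` _]setIC.
Qed.

(** Both approximants are rewritten as unions of cells of the finer of the two levels, and the
    errors add. *)
Lemma approximableU E F : approximable E -> approximable F -> approximable (E `|` F).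
Proof.
move=> [mE aE] [mF aF]; split; first exact: measurableU.
move=> k e e0.
have e20 : 0 < e / 2 by rewrite divr_gt0.
have [K1 [Q1 [kK1 h1 h1']]] := aE k _ e20.
have [K2 [Q2 [kK2 h2 h2']]] := aF k _ e20.
have [Q1' e1] := preimage_idx_refine Q1 (leq_maxl K1 K2).
have [Q2' e2] := preimage_idx_refine Q2 (leq_maxr K1 K2).
rewrite e1 in h1 h1'; rewrite e2 in h2 h2'.
have half (A B C : set X) : measurable A -> measurable B -> measurable C ->
    (mu A <= (e / 2)%:E)%E -> (mu B <= (e / 2)%:E)%E -> C `<=` A `|` B ->
    (mu C <= e%:E)%E.
  move=> mA mB mC hA hB CAB; rewrite (splitr e) EFinD.
  apply: le_trans (leeD hA hB); apply: le_trans (measureU2 _ mA mB).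
  by apply: le_measure; rewrite ?inE//; exact: measurableU.
exists (maxn K1 K2), (Q1' `|` Q2'); rewrite preimage_setU.
have mm A B : measurable A -> measurable B -> measurable (S0 `&` (A `\` B)).
  by move=> mA mB; apply: measurableI => //; exact: measurableD.
split; first by rewrite (leq_trans kK1)// leq_maxl.
- apply: half h1 h2 _; try (by apply: mm => //; exact: measurableU).
  move=> x [Sx [[Ex|Fx] /not_orP[n1 n2]]]; first by left.
  by right.
- apply: half h1' h2' _; try (by apply: mm => //; exact: measurableU).
  move=> x [Sx [[Ex|Fx] /not_orP[n1 n2]]]; first by left.
  by right.
Qed.

(** Since [S0] has finite measure, the part of the union missed by the first [N] sets tends to zero
    in measure; the finite union is then approximated. *)
Lemma approximable_bigcup (E : (set X)^nat) :
  (forall n, approximable (E n)) -> approximable (\bigcup_n E n).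
Proof.
move=> aE; have mE n : measurable (E n) by have [] := aE n.
split; first exact: bigcupT_measurable.
pose EN N := \big[setU/set0]_(i < N) E i.
have aEN N : approximable (EN N).
  rewrite /EN; elim: N => [|N IH].
    by rewrite big_ord0 -(preimage_set0 (idx 0)); exact: approximable_preimage_idx.
  by rewrite big_ord_recr; exact: approximableU.
have mEN N : measurable (EN N) by have [] := aEN N.
pose H N := S0 `&` (\bigcup_n E n `\` EN N).
have mH N : measurable (H N).
  apply: measurableI => //; apply: measurableD => //; exact: bigcupT_measurable.
have H0 : \bigcap_N H N = set0.
  apply/seteqP; split => // x Hx; have [_ [[n _ Enx] _]] := Hx 0%N Logic.I.
  have [_ [_ nE]] := Hx n.+1 Logic.I; apply: nE.
  by rewrite /EN -bigcup_mkord; exists n => //=.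
have mu_H : mu \o H @ \oo --> 0%E.
  rewrite -(measure0 mu) -H0; apply: nonincreasing_cvg_mu => //.
  - apply: le_lt_trans mu_S0; apply: le_measure; rewrite ?inE//.
    exact: subIsetl.
  - by rewrite H0.
  - move=> a b ab; apply/subsetPset => x [Sx [Ex nE]]; split => //; split => //.
    apply: contra_not nE; rewrite /EN -!bigcup_mkord => -[n na En].
    by exists n => //=; exact: leq_trans na ab.
move=> k e e0; have e20 : 0 < e / 2 by rewrite divr_gt0.
have [N hN] : exists N, (mu (H N) <= (e / 2)%:E)%E.
  apply: contrapT => /forallNP hN.
  have : ((e / 2)%:E <= 0 :> \bar R)%E.
    apply: (cvge_ge _ mu_H); apply: nearW => n /=.
    by have /negP := hN n; rewrite -ltNge => /ltW.
  by rewrite lee_fin leNgt e20.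
have [K [Q [kK h1 h2]]] := (aEN N).2 k _ e20.
exists K, Q; split => //.
- rewrite (splitr e) EFinD; apply: le_trans (leeD hN h1).
  have mA : measurable (S0 `&` (EN N `\` idx K @^-1` Q)).
    by apply: measurableI => //; exact: measurableD.
  apply: le_trans (measureU2 _ (mH N) mA); apply: le_measure; rewrite ?inE.
  + apply: measurableI => //; apply: measurableD => //; exact: bigcupT_measurable.
  + exact: measurableU.
  + move=> x [Sx [Ex nQ]]; have [ENx|nENx] := pselect (EN N x); first by right.
    by left.
- apply: (@le_trans _ _ (e / 2)%:E); last by rewrite lee_fin; lra.
  apply: le_trans h2; apply: le_measure; rewrite ?inE.
  + apply: measurableI => //; apply: measurableD => //; exact: bigcupT_measurable.
  + by apply: measurableI => //; exact: measurableD.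
  + move=> x [Sx [Qx nE]]; split => //; split => //; apply: contra_not nE.
    by rewrite /EN -bigcup_mkord => -[n _ En]; exists n.
Qed.

Definition cell_unions : set (set X) :=
  [set F | exists k Q, F = idx k @^-1` Q].

(** The approximable sets form a sigma-algebra containing the unions of cells. *)
Lemma approximable_sigma E : <<s cell_unions >> E -> approximable E.
Proof.
apply: smallest_sub; last first.
  by move=> _ [k [Q ->]]; exact: approximable_preimage_idx.
split.
- by rewrite -(preimage_set0 (idx 0)); exact: approximable_preimage_idx.
- by move=> A; rewrite setTD; exact: approximableC.
- exact: approximable_bigcup.
Qed.

(* A union F of cells close to E has mu E ~ mu (E n F) <= theta * mu F
   ~ theta * mu E. *)
Lemma approximable_null (E : set X) (m : nat -> R) (theta : R) k :
  approximable E -> E `<=` S0 -> 0 <= theta < 1 ->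
  (forall k' i, mu (cell k' i) = (m k')%:E) ->
  (forall k' i, (k <= k')%N -> (mu (E `&` cell k' i) <= (theta * m k')%:E)%E) ->
  mu E = 0%E.
Proof.
move=> [mE aE] ES /andP[th0 th1] mu_cell hE.
have Efin : mu E \is a fin_num.
  rewrite ge0_fin_numE//; apply: le_lt_trans mu_S0.
  by apply: le_measure; rewrite ?inE.
have [a aE'] : exists a, mu E = a%:E by exists (fine (mu E)); rewrite fineK.
have a0 : 0 <= a by rewrite -lee_fin -aE'.
rewrite aE'; congr EFin; apply/eqP; rewrite eq_le a0 andbT leNgt; apply/negP => a_gt0.
(* With this [e], the final bound [a <= e + theta * (a + e)] would give [4 * e <= 2 * e]. *)
have e0 : 0 < (1 - theta) * a / 4 by rewrite divr_gt0// mulr_gt0// subr_gt0.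
have [K [Q [kK h1 h2]]] := aE k _ e0; set e := _ / 4 in e0 h1 h2.
have mF : measurable (S0 `&` idx K @^-1` Q) by exact: measurableI.
have muF : (mu (S0 `&` idx K @^-1` Q) <= (a + e)%:E)%E.
  have mFE : measurable (S0 `&` ((idx K @^-1` Q) `\` E)).
    by apply: measurableI => //; exact: measurableD.
  rewrite EFinD -aE'; apply: le_trans (leeD (lexx _) h2).
  apply: le_trans (measureU2 _ mE mFE); apply: le_measure; rewrite ?inE//.
    exact: measurableU.
  move=> x [Sx Qx]; have [Ex|nEx] := pselect (E x); first by left.
  by right.
have EF : (mu (E `&` idx K @^-1` Q) <= theta%:E * (a + e)%:E)%E.
  apply: (@le_trans _ _ (theta%:E * mu (S0 `&` idx K @^-1` Q))%E); last first.
    by apply: lee_wpmul2l.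
  pose P : set I := [set i | Q i /\ cell K i `<=` S0].
  apply: (@le_trans _ _ (mu (\bigcup_(i in P) (E `&` cell K i)))).
    apply: le_measure; rewrite ?inE.
    - exact: measurableI.
    - by apply: bigcup_count_measurable => i _; exact: measurableI.
    - move=> x [Ex Qx]; exists (idx K x) => //; split => // y /= yx.
      by have := idx_nested_le idx_nested (leq0n K) yx; rewrite /cell/= => ->; exact: ES.
  apply: (measure_bigcup_le (B := cell K)) => //.
  - by move=> i _; exact: measurableI.
  - by move=> i j _ _ [x [/= <- <-]].
  - by move=> i [Qi sub] x xi; split; [exact: sub|rewrite /preimage/= xi].
  - by move=> i _; rewrite mu_cell -EFinM; exact: hE.
have : (mu E <= e%:E + theta%:E * (a + e)%:E)%E.
  have m1 : measurable (S0 `&` (E `\` idx K @^-1` Q)).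
    by apply: measurableI => //; exact: measurableD.
  have m2 : measurable (E `&` idx K @^-1` Q) by exact: measurableI.
  apply: le_trans (leeD h1 EF); apply: le_trans (measureU2 _ m1 m2).
  apply: le_measure; rewrite ?inE//; first exact: measurableU.
  move=> x Ex; have [Qx|nQx] := pselect ((idx K @^-1` Q) x); first by right.
  by left; split => //; exact: ES.
rewrite aE' -EFinM -EFinD lee_fin.
have : theta * e <= e by rewrite ler_piMl// ltW.
have : (1 - theta) * a = 4 * e by rewrite /e; field.
by clearbody e; lra.
Qed.

(* The floors of h at scale delta k are read off the level-k cell, and
   {h < a} is the union over k of {floor of h < floor of a at scale delta k}. *)
Lemma cell_unions_measurable_fun (h : X -> R) (o : R) (delta : nat -> R) :
  (forall k, 0 < delta k) ->
  (forall e, 0 < e -> exists k, delta k <= e) ->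
  (forall k x y, idx k x = idx k y ->
    Num.floor ((h x - o) / delta k) = Num.floor ((h y - o) / delta k)) ->
  measurable_fun setT (h : g_sigma_algebraType cell_unions -> measurableTypeR R).
Proof.
move=> d0 dlim hidx; apply: (measurability _ (RGenInftyO.measurableE R)).
move=> _ [_ [a ->] <-]; rewrite setTI.
pose fl k b := Num.floor ((b - o) / delta k).
rewrite (_ : _ @^-1` _ = \bigcup_k (idx k @^-1`
    [set i | exists2 x, idx k x = i & fl k (h x) < fl k a])).
  apply: bigcupT_measurable => k; apply: sub_sigma_algebra; exists k.
  by eexists.
apply/seteqP; split => [x|x [k _ [y xy]]]; rewrite /preimage/= in_itv/=.
- move=> hxa; have [k dk] : exists k, delta k <= a - h x.
    by apply: dlim; rewrite subr_gt0.
  exists k => //; exists x => //; rewrite /fl -lezD1 floor_ge_int_tmp intrD.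
  have : (h x - o) / delta k + 1 <= (a - o) / delta k.
    by rewrite -lerBrDl -mulrBl ler_pdivlMr// mul1r opprB addrA subrK.
  by apply: le_trans; rewrite lerD2r floor_le_tmp.
- rewrite /fl (hidx _ _ _ xy) => lt; rewrite ltNge; apply/negP => ax.
  move: lt; apply/negP; rewrite -leNgt; apply: le_floor.
  by rewrite ler_pM2r ?invr_gt0// lerD2r.
Qed.

End density.

(** * Lebesgue measure of boxes and Borel covers *)

Section spacetime_measure.
Context {R : realType}.
Local Notation B := (measurableTypeR R).

Lemma tuple_box_measurable n (A : 'I_n -> set B) :
  (forall i, measurable (A i)) ->
  measurable [set y : n.-tuple B | forall i, A i (tnth y i)].
Proof.
move=> mA; rewrite (_ : [set _ | _] =
    ~` \bigcup_(i in [set: 'I_n]) ~` ((@tnth n B ^~ i) @^-1` A i)).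
  apply: measurableC; apply: bigcup_count_measurable => i _.
  apply: measurableC; rewrite -[X in measurable X]setTI.
  exact: measurable_tnth.
apply/seteqP; split => [y Ay [i _]|y nAy i]; first by apply; exact: Ay.
by apply: contrapT => nA; apply: nAy; exists i.
Qed.

Lemma lebesgue_tuple_box n (A : 'I_n -> set B) (a : R) :
  (forall i, measurable (A i)) ->
  (forall i, lebesgue_measure (A i) = a%:E) ->
  lebesgue_tuple R n [set y | forall i, A i (tnth y i)] = (a ^+ n)%:E.
Proof.
elim: n A => [|n IH] A mA muA.
  rewrite expr0 /= /dirac indicE mem_set//.
  by case.
rewrite /= /lebesgue_cons /pushforward.
rewrite (_ : _ @^-1` _ =
    A ord0 `*` [set y : n.-tuple B | forall i, A (lift ord0 i) (tnth y i)]).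
  rewrite product_measure1E//; last first.
    by apply: (@tuple_box_measurable _ (fun i => A (lift ord0 i))).
  by rewrite [X in (X * _)%E]muA [X in (_ * X)%E](IH (fun i => A (lift ord0 i)))// -EFinM exprS.
apply/seteqP; split => [[y0 y] h|[y0 y] [h0 h] i].
  split; first by have := h ord0.
  by move=> i /=; have := h (lift ord0 i); rewrite tnthS.
by case: (unliftP ord0 i) => [j ->|->]; [rewrite tnthS; exact: h|exact: h0].
Qed.

Context (n : nat).
Local Notation mu2 := (lebesgue_tuple R n \x @lebesgue_measure R)%E.

Lemma spacetime_borel_measurable (A : set (n.-tuple B * B)) :
  measurable A -> measurable (A : set (spacetime R n)).
Proof. exact: caratheodory_measurable_mu_ext. Qed.

Lemma lebesgue_spacetime_borel (A : set (n.-tuple B * B)) :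
  measurable A -> lebesgue_spacetime (A : set (spacetime R n)) = mu2 A.
Proof. exact: measurable_mu_extE. Qed.

Lemma spacetime_box_measurable (A : set (n.-tuple B)) (T : set B) :
  measurable A -> measurable T -> measurable (A `*` T : set (spacetime R n)).
Proof. by move=> mA mT; apply: spacetime_borel_measurable; exact: measurableX. Qed.

Lemma lebesgue_spacetime_box (A : set (n.-tuple B)) (T : set B) (a b : R) :
  measurable A -> measurable T ->
  lebesgue_tuple R n A = a%:E -> lebesgue_measure T = b%:E ->
  lebesgue_spacetime (A `*` T : set (spacetime R n)) = (a * b)%:E.
Proof.
move=> mA mT ha hb; rewrite lebesgue_spacetime_borel; last exact: measurableX.
by rewrite product_measure1E// [X in (X * _)%E]ha [X in (_ * X)%E]hb -EFinM.
Qed.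

(** Lebesgue measure here is an outer measure, an infimum over countable Borel covers; the union of
    a nearly optimal cover serves. *)
Lemma spacetime_borel_cover (E : set (spacetime R n)) (e : R) :
  (lebesgue_spacetime E < +oo)%E -> 0 < e ->
  exists A : set (n.-tuple B * B), [/\ measurable A, E `<=` A &
    (lebesgue_spacetime (A : set (spacetime R n)) <= lebesgue_spacetime E + e%:E)%E].
Proof.
move=> Efin e0.
have Ef : lebesgue_spacetime E \is a fin_num by rewrite ge0_fin_numE.
have [_ [F [mF EF] <-] lt] := lb_ereal_inf_adherent e0 Ef.
have mUF : measurable (\bigcup_k F k) by exact: bigcupT_measurable.
exists (\bigcup_k F k); split => //.
rewrite lebesgue_spacetime_borel//; apply: le_trans (ltW lt).
exact: measure_sigma_subadditive.
Qed.

End spacetime_measure.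

(** * Approximating Lebesgue measurable sets by cells *)

Section spacetime_null.
Context {R : realType} (n : nat) (I : countType).
Local Notation X := (spacetime R n).
Local Notation B := (measurableTypeR R).
Local Notation mu := (@lebesgue_spacetime R n).
Variables (idx : nat -> X -> I) (i0 : I).
Local Notation S0 := (cell idx 0%N i0).
Hypothesis idx_nested :
  forall k x y, idx k.+1 x = idx k.+1 y -> idx k x = idx k y.
Hypothesis mcell : forall k i, measurable (cell idx k i).
Hypothesis mu_S0 : (mu S0 < +oo)%E.
Hypothesis fst_measurable : forall i, measurable_fun setT
  ((fun z : X => tnth z.1 i) : g_sigma_algebraType (cell_unions idx) -> B).
Hypothesis snd_measurable : measurable_fun setT
  ((fun z : X => z.2) : g_sigma_algebraType (cell_unions idx) -> B).

(** The identity map into the Borel structure is measurable for the sigma-algebra of cells because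
    each coordinate is. *)
Lemma borel_cell_unions (A : set (n.-tuple B * B)) :
  measurable A -> <<s cell_unions idx >> A.
Proof.
pose Y := g_sigma_algebraType (cell_unions idx).
have mid : measurable_fun setT ((fun z : X => z) : Y -> n.-tuple B * B).
  apply/measurable_fun_pairP; split; last exact: snd_measurable.
  by apply/measurable_fun_tnthP => i; exact: fst_measurable.
by move=> mA; have := mid measurableT A mA; rewrite setTI.
Qed.

(** Half of the error goes to replacing [E] by a Borel superset, the other half to approximating
    that superset. *)
Lemma spacetime_approximable (E : set X) :
  measurable E -> E `<=` S0 -> approximable mu idx i0 E.
Proof.
move=> mE ES; split => // k e e0.
have e20 : 0 < e / 2 by rewrite divr_gt0.
have muE : (mu E < +oo)%E.
  by apply: le_lt_trans mu_S0; apply: le_measure; rewrite ?inE.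
have [A [mA EA muA]] := spacetime_borel_cover muE e20.
have mA' := spacetime_borel_measurable mA.
have [_ aA] := approximable_sigma idx_nested mcell mu_S0 (borel_cell_unions mA).
have [K [Q [kK h1 h2]]] := aA k _ e20.
have mQ : measurable (idx K @^-1` Q) by exact: preimage_idx_measurable.
exists K, Q; split => //.
- apply: (@le_trans _ _ (e / 2)%:E); last by rewrite lee_fin; lra.
  apply: le_trans h1; apply: le_measure; rewrite ?inE.
  + by apply: measurableI => //; exact: measurableD.
  + by apply: measurableI => //; exact: measurableD.
  + by move=> x [Sx [Ex nQ]]; split => //; split => //; exact: EA.
- have hAE : (mu (A `\` E) <= (e / 2)%:E)%E.
    rewrite measureD//; last first.
      by apply: le_lt_trans muA _; rewrite lte_add_pinfty ?ltry.
    by rewrite setIidr// leeBlDl// ge0_fin_numE.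
  rewrite (splitr e) EFinD; apply: le_trans (leeD h2 hAE).
  have m1 : measurable (S0 `&` (idx K @^-1` Q `\` A)).
    by apply: measurableI => //; exact: measurableD.
  have m2 : measurable (A `\` E : set X) by exact: measurableD.
  apply: le_trans (measureU2 _ m1 m2); apply: le_measure; rewrite ?inE.
  + by apply: measurableI => //; exact: measurableD.
  + exact: measurableU.
  + move=> x [Sx [Qx nE]]; have [Ax|nAx] := pselect (A x); first by right.
    by left.
Qed.

End spacetime_null.

(** * Nested subdivisions of the line *)

Section subdivision.
Context {R : realType}.

Lemma floor_div_nat (u : R) (q : nat) : (0 < q)%N ->
  (Num.floor (u / q%:R) * q%:Z <= Num.floor u) /\
  (Num.floor u + 1 <= (Num.floor (u / q%:R) + 1) * q%:Z).
Proof.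
move=> q0; have q0' : 0 < q%:R :> R by rewrite ltr0n.
split.
  rewrite floor_ge_int_tmp intrM -ler_pdivlMr//; exact: floor_le_tmp.
rewrite lezD1 floor_lt_int intrM -ltr_pdivrMr//.
by have /andP[] := floor_itv (u / q%:R).
Qed.

Variables (delta : nat -> R) (q : nat -> nat).
Hypothesis delta_gt0 : forall k, 0 < delta k.
Hypothesis q_gt0 : forall k, (0 < q k)%N.
Hypothesis deltaS : forall k, delta k = (q k)%:R * delta k.+1.

Definition slot k (u : R) : int := Num.floor (u / delta k).

Let slotS k u : slot k u = Num.floor (u / delta k.+1 / (q k)%:R).
Proof. by rewrite /slot deltaS invfM mulrA mulrAC. Qed.

Lemma slotP k u j : slot k u = j <-> j%:~R * delta k <= u < (j + 1)%:~R * delta k.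
Proof.
rewrite -ler_pdivlMr// -ltr_pdivrMr//; split=> [<-|/floor_def//].
exact: floor_itv.
Qed.

(** Each slot is a union of [q k] whole slots of the next level, so two slots of level [k]
    containing the same finer slot coincide. *)
Lemma slot_nested k u v : slot k.+1 u = slot k.+1 v -> slot k u = slot k v.
Proof.
move=> uv; rewrite !slotS; rewrite /slot in uv.
have [h1 h2] := floor_div_nat (u / delta k.+1) (q_gt0 k).
have [h3 h4] := floor_div_nat (v / delta k.+1) (q_gt0 k).
rewrite uv in h1 h2; have q0 : 0 < (q k)%:Z by rewrite ltz_nat.
have le_of (F a c : int) : a * (q k)%:Z <= F -> F + 1 <= (c + 1) * (q k)%:Z -> a <= c.
  move=> h h'; rewrite -ltzD1 -(ltr_pM2r q0); apply: le_lt_trans h _.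
  by rewrite -lezD1.
by apply/eqP; rewrite eq_le (le_of _ _ _ h1 h4) (le_of _ _ _ h3 h2).
Qed.

Lemma slot_bounds j k u : (j <= k)%N ->
  (slot j u)%:~R * delta j <= (slot k u)%:~R * delta k /\
  (slot k u + 1)%:~R * delta k <= (slot j u + 1)%:~R * delta j.
Proof.
move=> /subnK <-; elim: (k - j)%N => // m [IH1 IH2].
have [h1 h2] := floor_div_nat (u / delta (m + j).+1) (q_gt0 (m + j)).
rewrite -slotS in h1 h2; have dE := deltaS (m + j); rewrite addSn; split.
- apply: le_trans IH1 _; rewrite dE mulrA ler_pM2r//.
  by rewrite -[(q _)%:R]/((Posz (q (m + j)))%:~R) -intrM ler_int.
- apply: le_trans IH2; rewrite dE mulrA ler_pM2r//.
  by rewrite -[(q _)%:R]/((Posz (q (m + j)))%:~R) -intrM ler_int.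
Qed.

End subdivision.

(** * Number of time slots per level *)

Section subdivision_count.
Context {R : realType}.

(* The number of time slots at level k: comparable to Q^k although Q = N^p is
   in general not an integer, and dividing the number of slots at level k+1. *)
Fixpoint slot_count (Q : R) k : nat :=
  if k is k'.+1 then
    (slot_count Q k' * (Num.truncn (Q ^+ k / (slot_count Q k')%:R)).+1)%N
  else 1%N.

Lemma slot_count_gt0 Q k : (0 < slot_count Q k)%N.
Proof. by elim: k => //= k IH; rewrite muln_gt0 IH. Qed.

(** Rounding up adds at most the previous count, which is at most [2 * Q ^+ k], hence at most
    [Q ^+ k.+1] when [Q >= 2]; so the factor 2 does not accumulate. *)
Lemma slot_count_bounds Q k : 2 <= Q ->
  Q ^+ k <= (slot_count Q k)%:R <= 2 * Q ^+ k.
Proof.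
move=> Q2; have Q0 : 0 < Q by lra.
elim: k => [|k /andP[IH1 IH2]]; first by rewrite expr0 /= lexx; lra.
have M0 : 0 < (slot_count Q k)%:R :> R by rewrite ltr0n slot_count_gt0.
set M := (slot_count Q k)%:R in IH1 IH2 M0 *.
have u0 : 0 <= Q ^+ k.+1 / M by rewrite divr_ge0// ltW// exprn_gt0.
have /andP[h1 h2] := truncn_itv u0.
rewrite [slot_count Q k.+1]/= natrM -/M; apply/andP; split.
  by rewrite mulrC -ler_pdivrMr// ltW.
rewrite -natr1 mulrDr mulr1.
apply: (@le_trans _ _ (Q ^+ k.+1 + M)).
  by rewrite lerD2r mulrC -ler_pdivlMr.
by rewrite mulrDl mul1r lerD2l (le_trans IH2)// exprS ler_pM2r// exprn_gt0.
Qed.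

End subdivision_count.

(** * Time orientation and the measure of rectangle parts *)

Section oriented_time.
Context {R : realType}.
Local Notation B := (measurableTypeR R).

(* b = true reverses time, so that the lower part of a rectangle becomes its
   upper part. *)
Definition oriented (b : bool) (t tau : R) : R := if b then t - tau else tau - t.

Definition tco b t u v : set B := [set tau | u <= oriented b t tau < v].
Definition too b t u v : set B := [set tau | u < oriented b t tau < v].

Let tcoE b t u v :
  tco b t u v = if b then `]t - v, t - u]%classic else `[t + u, t + v[%classic.
Proof.
by case: b; apply/seteqP; split => tau; rewrite /tco/oriented/= in_itv/=;
  move=> /andP[h1 h2]; apply/andP; split; lra.
Qed.

Let tooE b t u v :
  too b t u v = if b then `]t - v, t - u[%classic else `]t + u, t + v[%classic.
Proof.
by case: b; apply/seteqP; split => tau; rewrite /too/oriented/= in_itv/=;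
  move=> /andP[h1 h2]; apply/andP; split; lra.
Qed.

Lemma tco_measurable b t u v : measurable (tco b t u v).
Proof. by rewrite tcoE; case: b; exact: measurable_itv. Qed.

Lemma too_measurable b t u v : measurable (too b t u v).
Proof. by rewrite tooE; case: b; exact: measurable_itv. Qed.

Lemma lebesgue_tco b t u v : u < v -> lebesgue_measure (tco b t u v) = (v - u)%:E.
Proof.
by move=> uv; rewrite tcoE; case: b; rewrite lebesgue_measure_itv/= lte_fin
  ?ltrD2l ?ltrN2 uv -EFinD; congr EFin; ring.
Qed.

Lemma lebesgue_too b t u v : u < v -> lebesgue_measure (too b t u v) = (v - u)%:E.
Proof.
by move=> uv; rewrite tooE; case: b; rewrite lebesgue_measure_itv/= lte_fin
  ?ltrD2l ?ltrN2 uv -EFinD; congr EFin; ring.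
Qed.

Context (n : nat).
Local Notation X := (spacetime R n).
Local Notation mu := (@lebesgue_spacetime R n).

Definition pside (b : bool) (p g : R) (x : n.-tuple R) (t L : R) : set X :=
  if b then prect_lower p g x t L else prect_upper p g x t L.

Lemma psideE b p g x t L :
  pside b p g x t L = cube x L `*` too b t (g * L `^ p) (L `^ p).
Proof. by rewrite tooE; case: b. Qed.

Lemma psideNE b p g x t L :
  pside (~~ b) p g x t L = cube x L `*` too b t (- L `^ p) (- (g * L `^ p)).
Proof. by rewrite tooE; case: b; rewrite /= ?opprK. Qed.

Lemma prectE b p (x : n.-tuple R) t L :
  prect p x t L = cube x L `*` too b t (- L `^ p) (L `^ p) :> set X.
Proof. by rewrite tooE; case: b; rewrite /= ?opprK. Qed.

Let cubeE (x : n.-tuple R) (L : R) : cube x L =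
  [set y : n.-tuple B | forall i, `[tnth x i - L, tnth x i + L]%classic (tnth y i)].
Proof.
by apply/seteqP; split => y h i; have := h i; rewrite /= in_itv/= ler_distl.
Qed.

Lemma cube_measurable (x : n.-tuple R) (L : R) :
  measurable (cube x L : set (n.-tuple B)).
Proof.
rewrite cubeE.
apply: (tuple_box_measurable (A := fun i => `[tnth x i - L, tnth x i + L]%classic)) => i.
exact: measurable_itv.
Qed.

Lemma lebesgue_cube (x : n.-tuple R) (L : R) : 0 < L ->
  lebesgue_tuple R n (cube x L) = ((2 * L) ^+ n)%:E.
Proof.
move=> L0; rewrite cubeE.
apply: (lebesgue_tuple_box (A := fun i => `[tnth x i - L, tnth x i + L]%classic)) => i.
  exact: measurable_itv.
rewrite lebesgue_measure_itv/= lte_fin -EFinD ifT; last by lra.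
by congr EFin; ring.
Qed.

Lemma pside_measurable b p g x t L : measurable (pside b p g x t L).
Proof.
rewrite psideE; apply: spacetime_box_measurable; [exact: cube_measurable|].
exact: too_measurable.
Qed.

Lemma prect_measurable p (x : n.-tuple R) t L : measurable (prect p x t L : set X).
Proof.
rewrite (prectE false); apply: spacetime_box_measurable; [exact: cube_measurable|].
exact: too_measurable.
Qed.

Lemma lebesgue_pside b p g x t L : 0 < L -> g < 1 ->
  mu (pside b p g x t L) = ((2 * L) ^+ n * ((1 - g) * L `^ p))%:E.
Proof.
move=> L0 g1; rewrite psideE; apply: lebesgue_spacetime_box.
- exact: cube_measurable.
- exact: too_measurable.
- exact: lebesgue_cube.
- have Lp : 0 < L `^ p by exact: powR_gt0.
  by rewrite lebesgue_too; [congr EFin; ring|rewrite gtr_pMl].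
Qed.

Lemma pside_sub b p g x t L : 0 < L -> -1 < g -> pside b p g x t L `<=` prect p x t L.
Proof.
move=> L0 g1; rewrite psideE (prectE b) => z [? /andP[h1 h2]]; split => //.
apply/andP; split => //; apply: lt_trans h1; have := powR_gt0 p L0; nra.
Qed.

End oriented_time.

(** * The parabolic grid and the one-sided estimate *)

Section one_sided.
Context {R : realType} (n : nat).
Local Notation B := (measurableTypeR R).
Local Notation X := (spacetime R n).
Local Notation mu := (@lebesgue_spacetime R n).
Variables (b : bool) (p gamma alpha : R) (N J : nat) (x : n.-tuple R) (t L : R).
Hypothesis p_gt1 : 1 < p.
Hypothesis gamma_ge0 : 0 <= gamma.
Hypothesis gamma_alpha : gamma < alpha.
Hypothesis alpha_lt1 : alpha < 1.
Hypothesis N_big : 2 <= (alpha - gamma) * N%:R.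
Hypothesis J_big : 4 <= (1 - alpha) * J%:R.
Hypothesis L_gt0 : 0 < L.

(** At level [k], [ell k] is half the side of the cubes, [H k] half the height of the attached
    rectangles and [T k] the height of the cells, which lies between half of [(1 - alpha) * H k] and
    all of it. The bottom of the root cell is at [u0]. *)
Let Q : R := N%:R `^ p.
Let ell k : R := L / N%:R ^+ k.
Let H k : R := L `^ p / Q ^+ k.
Let T k : R := (1 - alpha) * L `^ p / (slot_count Q k)%:R.
Let u0 : R := alpha * L `^ p.

Let N_gt2 : 2 < N%:R :> R.
Proof.
rewrite ltNge; apply/negP => N2.
have : (alpha - gamma) * N%:R <= (alpha - gamma) * 2 by rewrite ler_pM2l ?subr_gt0.
by move=> /(le_trans N_big); move: gamma_ge0 alpha_lt1; lra.
Qed.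

Let N_gt0 : 0 < N%:R :> R. Proof. exact: lt_trans N_gt2. Qed.

Let Nk_gt0 k : 0 < N%:R ^+ k :> R. Proof. exact: exprn_gt0. Qed.

Let N_le_Q : N%:R <= Q.
Proof.
rewrite -[leLHS]powRr1 ?ler0n// /Q; apply: ler_powR; last exact: ltW.
by apply: ltW; apply: lt_trans N_gt2; rewrite ltr1n.
Qed.

Let Q_ge2 : 2 <= Q. Proof. exact: le_trans (ltW N_gt2) N_le_Q. Qed.

Let Q_gt0 : 0 < Q. Proof. by have := Q_ge2; lra. Qed.

Let Qk_gt0 k : 0 < Q ^+ k. Proof. exact: exprn_gt0. Qed.

Let Lp_gt0 : 0 < L `^ p. Proof. exact: powR_gt0. Qed.

Let ell_gt0 k : 0 < ell k. Proof. by rewrite divr_gt0. Qed.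

Let H_gt0 k : 0 < H k. Proof. by rewrite divr_gt0. Qed.

Let ell_powR k : ell k `^ p = H k.
Proof.
have powX : (N%:R ^+ k) `^ p = Q ^+ k.
  elim: k => [|k IH]; first by rewrite !expr0 powR1.
  by rewrite !exprS powRM ?IH// ltW.
rewrite /H -powX; apply: (mulIf (lt0r_neq0 (powR_gt0 p (Nk_gt0 k)))).
rewrite divfK ?lt0r_neq0 ?powR_gt0// -powRM; first by rewrite divfK// lt0r_neq0.
  exact/ltW/ell_gt0.
exact: ltW.
Qed.

Let ellS k : ell k = N%:R * ell k.+1.
Proof. by rewrite /ell exprS; field; rewrite !lt0r_neq0. Qed.

Let HS k : H k = Q * H k.+1.
Proof. by rewrite /H exprS; field; rewrite !lt0r_neq0. Qed.

Let T0_gt0 : 0 < (1 - alpha) * L `^ p. Proof. by rewrite mulr_gt0 ?subr_gt0. Qed.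

Let count_gt0 k : 0 < (slot_count Q k)%:R :> R.
Proof. by rewrite ltr0n slot_count_gt0. Qed.

Let T_gt0 k : 0 < T k. Proof. by rewrite divr_gt0. Qed.

Let T_le k : T k <= (1 - alpha) * H k.
Proof.
have /andP[h _] := slot_count_bounds k Q_ge2.
by rewrite /T /H mulrA ler_pM2l// lef_pV2 ?posrE.
Qed.

Let T_ge k : (1 - alpha) * H k <= 2 * T k.
Proof.
have /andP[_ h] := slot_count_bounds k Q_ge2.
by rewrite /T /H [leLHS]mulrA [leRHS]mulrCA ler_pM2l// ler_pdivlMr// mulrC ler_pdivrMr.
Qed.

Let q k : nat := (Num.truncn (Q ^+ k.+1 / (slot_count Q k)%:R)).+1.

Let TS k : T k = (q k)%:R * T k.+1.
Proof.
rewrite /T [slot_count Q k.+1]/= natrM -/(q k) invfM.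
have q0 : (q k)%:R != 0 :> R by rewrite pnatr_eq0.
by field; rewrite q0 lt0r_neq0.
Qed.

(** Shows how large [N] must be: a finer rectangle, of full height [2 * H k], fits into the gap
    between the levels [gamma] and [alpha] of a coarser one. *)
Let H_gap j k : (j < k)%N -> 2 * H k <= (alpha - gamma) * H j.
Proof.
elim: k => // k IH; rewrite ltnS leq_eqVlt => /predU1P[->|/IH le].
  rewrite (HS k) mulrA ler_pM2r//; apply: le_trans N_big _.
  by rewrite ler_pM2l ?subr_gt0.
apply: le_trans le; rewrite ler_pM2l// (HS k) ler_peMl//; first exact: ltW.
by have := Q_ge2; lra.
Qed.

Let dS k : R := 2 * ell k.

Let dS_gt0 k : 0 < dS k. Proof. by rewrite mulr_gt0. Qed.

Let dSS k : dS k = N%:R * dS k.+1.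
Proof. by rewrite /dS (ellS k) mulrCA. Qed.

Let N_pos : (0 < N)%N. Proof. by rewrite -(ltr0n R). Qed.

Let sslot k (y : n.-tuple R) : n.-tuple int :=
  [tuple slot dS k (tnth y l - (tnth x l - L)) | l < n].

Let tslot k (tau : R) : int := slot T k (oriented b t tau - u0).

Let I : countType := (n.-tuple int * int)%type.

Let idx k (z : X) : I := (sslot k z.1, tslot k z.2).

Let sslot_nested k y y' : sslot k.+1 y = sslot k.+1 y' -> sslot k y = sslot k y'.
Proof.
move=> h; apply: eq_from_tnth => l; rewrite !tnth_mktuple.
apply: (slot_nested (q := fun=> N)) => //.
by have := congr1 (fun s => tnth s l) h; rewrite /= !tnth_mktuple.
Qed.

Let idx_nested k z z' : idx k.+1 z = idx k.+1 z' -> idx k z = idx k z'.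
Proof.
move=> h; have h1 := congr1 fst h; have h2 := congr1 snd h.
by rewrite /idx (sslot_nested h1); congr pair; apply: (slot_nested (q := q)) h2.
Qed.

(* Half-open cubes, so that the cells of a level are disjoint; the parts Pp, Pm
   below also use them, at the cost of a null set. *)
Let scell k s : set (n.-tuple B) := [set y | sslot k y = s].

Let scellP k s y : scell k s y <-> forall l,
  (tnth s l)%:~R * dS k <= tnth y l - (tnth x l - L) < (tnth s l + 1)%:~R * dS k.
Proof.
split=> [<- l|h]; first by rewrite tnth_mktuple; exact/(slotP dS_gt0).
by apply: eq_from_tnth => l; rewrite tnth_mktuple; exact/(slotP dS_gt0).
Qed.

Let scell_itv k (s : n.-tuple int) l : set B :=
  `[tnth x l - L + (tnth s l)%:~R * dS k,
    tnth x l - L + (tnth s l + 1)%:~R * dS k[%classic.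

Let scellE k s : scell k s = [set y : n.-tuple B | forall l, scell_itv k s l (tnth y l)].
Proof.
apply/seteqP; split => [y /scellP h l|y h]; last apply/scellP => l.
  by have := h l; rewrite /scell_itv/= in_itv/= => /andP[h1 h2]; apply/andP; split; lra.
by have := h l; rewrite /scell_itv/= in_itv/= => /andP[h1 h2]; apply/andP; split; lra.
Qed.

Let scell_measurable k s : measurable (scell k s).
Proof.
rewrite scellE; apply: (tuple_box_measurable (A := scell_itv k s)) => l.
exact: measurable_itv.
Qed.

Let lebesgue_scell k s : lebesgue_tuple R n (scell k s) = (dS k ^+ n)%:E.
Proof.
rewrite scellE; apply: (lebesgue_tuple_box (A := scell_itv k s)) => l.
  exact: measurable_itv.
rewrite lebesgue_measure_itv/= lte_fin -EFinD intrD ifT; last first.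
  by have := dS_gt0 k; nra.
by congr EFin; ring.
Qed.

Let box_measurable k s (S : set B) : measurable S -> measurable (scell k s `*` S : set X).
Proof. by move=> mS; apply: spacetime_box_measurable => //. Qed.

Let lebesgue_box k s (S : set B) (c : R) : measurable S -> lebesgue_measure S = c%:E ->
  mu (scell k s `*` S) = (dS k ^+ n * c)%:E.
Proof. by move=> mS hS; apply: lebesgue_spacetime_box => //; exact: lebesgue_scell. Qed.

Let bot k (j : int) : R := u0 + j%:~R * T k.
Let top k (j : int) : R := u0 + (j + 1)%:~R * T k.

Let topE k j : top k j = bot k j + T k.
Proof. by rewrite /top /bot intrD mulrDl mul1r addrA. Qed.

Let cellE k i : cell idx k i = scell k i.1 `*` tco b t (bot k i.2) (top k i.2).
Proof.
case: i => s j; apply/seteqP; split => [z [h1 h2]|z [/= h1 /andP[h2 h3]]].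
  split => //=; move: h2 => /(slotP T_gt0)/andP[h3 h4].
  by apply/andP; rewrite /bot /top; split; lra.
rewrite /cell /idx /= h1; congr pair.
by apply/(slotP T_gt0); apply/andP; move: h2 h3; rewrite /bot /top; split; lra.
Qed.


Let m k : R := dS k ^+ n * T k.
Let v k : R := dS k ^+ n * ((1 - gamma) * H k).

Let m_gt0 k : 0 < m k. Proof. by rewrite mulr_gt0// exprn_gt0. Qed.

Let bot_lt_top k j : bot k j < top k j. Proof. by rewrite topE ltrDl. Qed.

Let mcell k i : measurable (cell idx k i).
Proof. by rewrite cellE; apply: box_measurable; exact: tco_measurable. Qed.

Let mu_cell k i : mu (cell idx k i) = (m k)%:E.
Proof.
rewrite cellE; apply: lebesgue_box; first exact: tco_measurable.
by rewrite lebesgue_tco// topE addrAC subrr add0r.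
Qed.

Let i0 : I := ([tuple 0 | _ < n], 0).

Let mu_S0 : (mu (cell idx 0 i0) < +oo)%E.
Proof. by rewrite mu_cell ltry. Qed.

Let small (c e : R) (r : R) : 0 <= c -> 2 <= r -> 0 < e -> exists k, c / r ^+ k <= e.
Proof.
move=> c0 r2 e0; exists (Num.truncn (c / e)).+1.
have r0 k : 0 < r ^+ k by rewrite exprn_gt0//; lra.
rewrite ler_pdivrMr// mulrC -ler_pdivrMr//.
have /andP[_ h] := truncn_itv (divr_ge0 c0 (ltW e0)).
apply: le_trans (ltW h) _.
apply: (@le_trans _ _ (2 ^+ (Num.truncn (c / e)).+1)); last first.
  by apply: lerXn2r => //; rewrite nnegrE; lra.
by rewrite -natrX ler_nat; apply/ltnW/ltn_expl.
Qed.

Let null_criterion (E : set X) (theta : R) k :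
  measurable E -> E `<=` cell idx 0 i0 -> 0 <= theta < 1 ->
  (forall k' i, (k <= k')%N -> (mu (E `&` cell idx k' i) <= (theta * m k')%:E)%E) ->
  mu E = 0%E.
Proof.
move=> mE ES th hE.
apply: (approximable_null idx_nested mcell mu_S0 _ ES th mu_cell hE).
apply: (spacetime_approximable idx_nested mcell mu_S0) => //.
- move=> l; apply: (cell_unions_measurable_fun (o := tnth x l - L) (delta := dS)) => //.
    move=> e e0; have L2 : 0 <= 2 * L by rewrite mulr_ge0// ltW.
    have [k' hk'] := small L2 (ltW N_gt2) e0.
    by exists k'; rewrite /dS /ell mulrA.
  move=> k' z z' /(congr1 (fun i => tnth i.1 l)); rewrite /= !tnth_mktuple.
  exact.
- have mor : measurable_fun setT ((fun z : X => oriented b t z.2) :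
      g_sigma_algebraType (cell_unions idx) -> B).
    apply: (cell_unions_measurable_fun (o := u0) (delta := T)) => //.
      move=> e e0; have [k' hk'] := small (ltW T0_gt0) Q_ge2 e0; exists k'.
      apply: le_trans hk'; rewrite /T ler_pM2l// lef_pV2 ?posrE//.
      by have /andP[] := slot_count_bounds k' Q_ge2.
    by move=> k' z z' /(congr1 snd).
  (* The grid controls only the oriented time; the time coordinate is an affine function of it. *)
  rewrite (_ : (fun z : X => z.2) =
      (fun z : X => if b then t - oriented b t z.2 else oriented b t z.2 + t)).
    case: b mor => mor.
      by apply: measurable_funB => //; exact: measurable_cst.
    by apply: measurable_funD => //; exact: measurable_cst.
  by apply/funext => z; rewrite /oriented; case: b; ring.
Qed.

Let D k (i : I) : set X :=
  scell k i.1 `*` tco b t (bot k i.2) (bot k i.2 + J%:R * T k).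

Let J_ge1 : 1 <= J%:R :> R.
Proof.
rewrite ler1n -(ltr0n R) ltNge; apply/negP => J0.
have : (1 - alpha) * J%:R <= 0 by rewrite mulr_ge0_le0// subr_ge0 ltW.
by move=> /(le_trans J_big); rewrite lern0.
Qed.

Let J_gt0 : (0 < J)%N. Proof. by rewrite -(ler1n R). Qed.

Let D_measurable k i : measurable (D k i).
Proof. by apply: box_measurable; exact: tco_measurable. Qed.

Let mu_D k i : (mu (D k i) <= (J%:R * m k)%:E)%E.
Proof.
have JT : 0 < J%:R * T k by rewrite mulr_gt0// ltr0n.
rewrite (@lebesgue_box _ _ _ (J%:R * T k)); [|exact: tco_measurable|].
  by rewrite /m mulrCA.
by rewrite lebesgue_tco ?ltrDl// addrAC subrr add0r.
Qed.

Let bounds k k' z : (k <= k')%N ->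
  bot k (idx k z).2 <= bot k' (idx k' z).2 /\ top k' (idx k' z).2 <= top k (idx k z).2.
Proof.
move=> kk'; rewrite /bot /top !lerD2l.
exact: (slot_bounds T_gt0 (q := q) _ TS).
Qed.

Let scell_sub k k' z : (k <= k')%N -> scell k' (idx k' z).1 `<=` scell k (idx k z).1.
Proof.
move=> /subnK <-; elim: (k' - k)%N => // j IH.
rewrite addSn; apply: subset_trans IH => y; exact: sslot_nested.
Qed.

(** The dilation ends [J - 1] cell heights above the top of its cell; both the top and the cell
    height can only shrink at the next level. *)
Let D_nested k z : D k.+1 (idx k.+1 z) `<=` D k (idx k z).
Proof.
move=> y [h1 /andP[h2 h3]]; have [b1 b2] := bounds z (leqnSn k).
split; first exact: scell_sub h1.
apply/andP; split; first exact: le_trans b1 h2.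
apply: lt_le_trans h3 _; rewrite !topE in b2.
have TT : T k.+1 <= T k.
  by rewrite (TS k) ler_peMl ?ler1n//; exact: ltW.
have : (J%:R - 1) * T k.+1 <= (J%:R - 1) * T k by rewrite ler_wpM2l// subr_ge0.
by lra.
Qed.

Let U : set X := prect p x t L.

(** In oriented time the attached rectangle is centred at [top - H k] with half-height [H k], so
    that it shares the top of its cell. *)
Let Pp k (i : I) : set X :=
  scell k i.1 `*` too b t (top k i.2 - (1 - gamma) * H k) (top k i.2).
Let Pm k (i : I) : set X :=
  scell k i.1 `*` too b t (top k i.2 - 2 * H k) (top k i.2 - (1 + gamma) * H k).

Let gamma_lt1 : gamma < 1. Proof. exact: lt_trans alpha_lt1. Qed.

Let H1_gt0 k : 0 < (1 - gamma) * H k. Proof. by rewrite mulr_gt0// subr_gt0. Qed.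

Let Pp_measurable k i : measurable (Pp k i).
Proof. by apply: box_measurable; exact: too_measurable. Qed.

Let Pm_measurable k i : measurable (Pm k i).
Proof. by apply: box_measurable; exact: too_measurable. Qed.

Let mu_Pp k i : mu (Pp k i) = (v k)%:E.
Proof.
apply: lebesgue_box; first exact: too_measurable.
by rewrite lebesgue_too ?gtrBl//; congr EFin; ring.
Qed.

Let mu_Pm k i : mu (Pm k i) = (v k)%:E.
Proof.
apply: lebesgue_box; first exact: too_measurable.
by have := H1_gt0 k => h; rewrite lebesgue_too; [congr EFin; ring|lra].
Qed.

Let cell_Pp k i : cell idx k i `<=` Pp k i.
Proof.
rewrite cellE => z [h1 /andP[h2 h3]]; split => //; apply/andP; split => //.
apply: lt_le_trans h2; rewrite topE.
have : (1 - alpha) * H k < (1 - gamma) * H k by rewrite ltr_pM2r// ltrD2l ltrN2.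
by have := T_le k; lra.
Qed.

(** The finer rectangle starts above [bot k - 2 * H k']. Here [bot k] is at least
    [top k - (1 - alpha) * H k], and [H_gap] bounds [2 * H k'] by [(alpha - gamma) * H k]; together
    they leave [top k - (1 - gamma) * H k], the bottom of [Pp]. *)
Let Pm_Pp k k' z : (k < k')%N -> Pm k' (idx k' z) `<=` Pp k (idx k z).
Proof.
move=> kk' y [h1 /andP[h2 h3]]; have [b1 b2] := bounds z (ltnW kk').
split; first exact: (scell_sub (ltnW kk')) h1.
have hg := H_gap kk'; have hT := T_le k; have hT' := T_gt0 k'.
have hH' : 0 < (1 + gamma) * H k' by rewrite mulr_gt0// ltr_pwDl.
move: b1 b2 h2 h3; rewrite !topE => b1 b2 h2 h3; apply/andP; split; lra.
Qed.

Let vK0 k : v k <= 2 * (1 - gamma) / (1 - alpha) * m k.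
Proof.
rewrite /v /m [leRHS]mulrCA ler_pM2l ?exprn_gt0//.
have a0 : 0 < 1 - alpha by rewrite subr_gt0.
rewrite mulrAC ler_pdivlMr//.
have : (1 - gamma) * ((1 - alpha) * H k) <= (1 - gamma) * (2 * T k).
  by rewrite ler_wpM2l// subr_ge0 ltW.
by lra.
Qed.

Let vK1 k : v k <= N%:R ^+ n * Q * v k.+1.
Proof. by rewrite /v (dSS k) (HS k) exprMn le_eqVlt; apply/orP; left; apply/eqP; ring. Qed.

(** Same cube, [l] time slots earlier; [l = 0] is the cell itself. *)
Let below (k : nat) (i : I) (l : 'I_J) : I := (i.1, i.2 - l%:Z).

Let JT k : 2 * H k <= J%:R * T k.
Proof.
have : J%:R * ((1 - alpha) * H k) <= J%:R * (2 * T k) by rewrite ler_wpM2l.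
have : 4 * H k <= (1 - alpha) * J%:R * H k by rewrite ler_pM2r.
by lra.
Qed.

(** The lower part reaches at most [2 * H k] below the top of the cell, and [J] slots span that
    height. *)
Let Pm_below k i : Pm k i `<=` \bigcup_l cell idx k (below k i l).
Proof.
case: i => s j z [/= h1 /andP[/= h2 h3]].
set j' := tslot k z.2.
have /(slotP T_gt0)/andP[k1 k2] : slot T k (oriented b t z.2 - u0) = j' by [].
have hH' : 0 < (1 + gamma) * H k by rewrite mulr_gt0// ltr_pwDl.
have j'j : j' <= j.
  rewrite -ltzD1 -(ltr_int R) -(ltr_pM2r (T_gt0 k)).
  by move: h2 h3; rewrite /top; lra.
have jj' : j - j' < J%:Z.
  rewrite -(ltr_int R) rmorphB/= -(ltr_pM2r (T_gt0 k)).
  have := JT k; move: h2 h3 k1 k2; rewrite /top !intrD -pmulrn; lra.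
have ltJ : (`|j - j'| < J)%N by rewrite -ltz_nat gez0_abs ?subr_ge0.
exists (Ordinal ltJ) => //; rewrite /cell/= /idx /below/= h1; congr pair.
by rewrite gez0_abs ?subr_ge0// opprB addrC subrK.
Qed.

Let cell_D k i l : cell idx k i `<=` D k (below k i l).
Proof.
rewrite cellE => z [h1 /andP[h2 h3]]; split => //=.
move: h2 h3; rewrite topE /bot intrB -pmulrn => h2 h3.
have l0 : 0 <= l%:R * T k by rewrite mulr_ge0// ltW.
have : (l%:R + 1) * T k <= J%:R * T k by rewrite ler_pM2r// natr1 ler_nat.
by move=> hJ; apply/andP; split; lra.
Qed.

Let xc k (s : n.-tuple int) : n.-tuple R :=
  [tuple tnth x l - L + (tnth s l)%:~R * dS k + ell k | l < n].
Let tc k (j : int) : R :=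
  if b then t - (top k j - H k) else t + (top k j - H k).

Let oriented_tc k j tau :
  oriented b (tc k j) tau = oriented b t tau - (top k j - H k).
Proof. by rewrite /oriented /tc; case: b; ring. Qed.

Let scell_cube k s : scell k s `<=` cube (xc k s) (ell k).
Proof.
move=> y /scellP h l; have /andP[h1 h2] := h l; rewrite tnth_mktuple ler_distl.
by move: h1 h2; rewrite /dS intrD => h1 h2; apply/andP; split; lra.
Qed.

Let Pp_pside k i : Pp k i `<=` pside b p gamma (xc k i.1) (tc k i.2) (ell k).
Proof.
move=> z [h1 /andP[h2 h3]]; rewrite psideE; split; first exact: scell_cube.
by rewrite /too/= oriented_tc ell_powR; apply/andP; split; lra.
Qed.

Let Pm_pside k i : Pm k i `<=` pside (~~ b) p gamma (xc k i.1) (tc k i.2) (ell k).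
Proof.
move=> z [h1 /andP[h2 h3]]; rewrite psideNE; split; first exact: scell_cube.
by rewrite /too/= oriented_tc ell_powR; apply/andP; split; lra.
Qed.

Let ell0 : ell 0 = L. Proof. by rewrite /ell expr0 divr1. Qed.
Let H0 : H 0 = L `^ p. Proof. by rewrite /H expr0 divr1. Qed.
Let T0 : T 0 = (1 - alpha) * L `^ p. Proof. by rewrite /T /= divr1. Qed.

Let top0 : top 0 0 = L `^ p.
Proof. by rewrite /top add0r mul1r T0 /u0; ring. Qed.

Let xc0 : xc 0 i0.1 = x.
Proof.
apply: eq_from_tnth => l; rewrite !tnth_mktuple ell0 mul0r addr0.
by rewrite subrK.
Qed.

Let tc0 : tc 0 0 = t.
Proof. by rewrite /tc top0 H0 subrr subr0 addr0; case: b. Qed.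

Let prect_sub k z : cell idx 0 i0 z ->
  prect p (xc k (idx k z).1) (tc k (idx k z).2) (ell k) `<=` U.
Proof.
move=> Sz; rewrite /U !(prectE b) => y [h1 /andP[h2 h3]]; split.
  move=> l; have := h1 l; rewrite tnth_mktuple !ler_distl.
  have [b1 b2] := slot_bounds dS_gt0 (fun=> N_pos) dSS
    (tnth z.1 l - (tnth x l - L)) (leq0n k).
  have s0 : slot dS 0 (tnth z.1 l - (tnth x l - L)) = 0.
    by have := congr1 (fun i => tnth i.1 l) Sz; rewrite /= !tnth_mktuple.
  move: b1 b2; rewrite s0 mul0r add0r mul1r /= tnth_mktuple intrD.
  rewrite [dS 0]/dS ell0 /dS => b1 b2 /andP[h4 h5].
  by apply/andP; split; lra.
have [b1 b2] := bounds z (leq0n k).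
have s0 : (idx 0 z).2 = 0 by rewrite Sz.
rewrite s0 top0 in b1 b2; rewrite {1}/bot mul0r addr0 /u0 in b1.
move: h2 h3; rewrite oriented_tc ell_powR => h2 h3; apply/andP; split; last by lra.
(* At level 0 the rectangle is the ambient one. At higher levels [H_gap] against level 0 keeps it
   above [gamma * L ^ p] in oriented time. *)
have [k0|k0] := posnP k.
  move: h2; rewrite k0 s0 top0 H0; lra.
have := H_gap k0; rewrite H0 => hg; have := T_gt0 k.
move: b1 h2; rewrite topE => b1 h2 hT.
have : 0 <= gamma * L `^ p by rewrite mulr_ge0// ltW.
by have := Lp_gt0; lra.
Qed.

Let gammaN1 : -1 < gamma. Proof. by apply: lt_le_trans gamma_ge0; rewrite ltrN10. Qed.

Let Pp_U k z : cell idx 0 i0 z -> Pp k (idx k z) `<=` U.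
Proof.
move=> Sz; apply: subset_trans (prect_sub Sz) => //.
by apply: subset_trans (@Pp_pside _ _) _; exact: pside_sub.
Qed.

Let Pm_U k z : cell idx 0 i0 z -> Pm k (idx k z) `<=` U.
Proof.
move=> Sz; apply: subset_trans (prect_sub Sz) => //.
by apply: subset_trans (@Pm_pside _ _) _; exact: pside_sub.
Qed.

Variables (s w r : R) (f : X -> \bar R) (c : n.-tuple R -> R -> R -> R).
Hypothesis s_gt0 : 0 < s.
Hypothesis s_le : s <= 2^-1.
Hypothesis s_K0 : s * (2 * (1 - gamma) / (1 - alpha)) < 1.
Hypothesis s_K1 : s * (N%:R ^+ n * N%:R `^ p) < 2^-1.
Hypothesis s_r : J%:R * (2 * J%:R) * (s * (2 * (1 - gamma) / (1 - alpha))) <= r.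
Hypothesis w_gt0 : 0 < w.
Hypothesis mf : measurable_fun (prect p x t L : set X) f.
Hypothesis f_upper : forall x' t' L', 0 < L' ->
  (prect p x' t' L' : set X) `<=` prect p x t L ->
  (mu (pside b p gamma x' t' L' `&` [set z | ((c x' t' L' + w)%:E < f z)%E]) <=
    s%:E * mu (pside b p gamma x' t' L'))%E.
Hypothesis f_lower : forall x' t' L', 0 < L' ->
  (prect p x' t' L' : set X) `<=` prect p x t L ->
  (mu (pside (~~ b) p gamma x' t' L' `&` [set z | (f z < (c x' t' L' - w)%:E)%E]) <=
    s%:E * mu (pside (~~ b) p gamma x' t' L'))%E.

Let mU : measurable U. Proof. exact: prect_measurable. Qed.

Let mgt := superlevel_measurable mU mf.
Let mlt := sublevel_measurable mU mf.

Let mu_pside b' k i :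
  mu (pside b' p gamma (xc k i.1) (tc k i.2) (ell k)) = (v k)%:E.
Proof. by rewrite lebesgue_pside// ell_powR. Qed.

Let ck k (i : I) : R := c (xc k i.1) (tc k i.2) (ell k).

Let hup k z : cell idx 0 i0 z ->
  (mu (Pp k (idx k z) `&` [set y | ((ck k (idx k z) + w)%:E < f y)%E]) <=
     (s * v k)%:E)%E.
Proof.
move=> Sz; rewrite EFinM -(mu_pside b k (idx k z)).
apply: le_trans (f_upper _ (prect_sub Sz)) => //.
apply: le_measure; rewrite ?inE.
- by apply: mgt => //; exact: Pp_U.
- apply: mgt; first exact: pside_measurable.
  by apply: subset_trans (prect_sub Sz); exact: pside_sub.
- by apply: setSI; exact: Pp_pside.
Qed.

Let hlow k z : cell idx 0 i0 z ->
  (mu (Pm k (idx k z) `&` [set y | (f y < (ck k (idx k z) - w)%:E)%E]) <=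
     (s * v k)%:E)%E.
Proof.
move=> Sz; rewrite EFinM -(mu_pside (~~ b) k (idx k z)).
apply: le_trans (f_lower _ (prect_sub Sz)) => //.
apply: le_measure; rewrite ?inE.
- by apply: mlt => //; exact: Pm_U.
- apply: mlt; first exact: pside_measurable.
  by apply: subset_trans (prect_sub Sz); exact: pside_sub.
- by apply: setSI; exact: Pm_pside.
Qed.

Lemma one_sided_decay k :
  (mu (pside b p alpha x t L `&` [set z | ((c x t L + 4 * w * k%:R)%:E < f z)%E]) <=
     (r ^+ k)%:E * mu (pside b p alpha x t L))%E.
Proof.
have alphaN1 : -1 < alpha by apply: lt_trans gamma_alpha.
set A := pside b p alpha x t L; set S := cell idx 0 i0.
have mA : measurable A by exact: pside_measurable.
have AU : A `<=` U by exact: pside_sub.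
have mS : measurable S by exact: mcell.
have SU : S `<=` U.
  move=> z Sz; apply: (Pp_U (k := 0%N) Sz); apply: cell_Pp.
  by [].
have muA : mu A = (m 0)%:E.
  by rewrite lebesgue_pside// /m T0 /dS ell0.
(* The part of level [alpha] and the root cell differ only in boundary faces; their intersection
   already has full measure, so the estimate on the cell transfers. *)
have AS : A `&` S = scell 0 i0.1 `*` too b t u0 (L `^ p).
  rewrite /A psideE /S cellE /bot mul0r addr0 top0.
  apply/seteqP; split => [z [[h1 h2] [h3 h4]]|z [h1 h2]]; first by split.
  split; split => //; first by rewrite -xc0 -[X in cube _ X]ell0; exact: scell_cube.
  by move: h2 => /andP[h2 h3]; apply/andP; split => //; exact: ltW.
have muAS : mu (A `&` S) = (m 0)%:E.
  rewrite AS /m T0; apply: lebesgue_box; first exact: too_measurable.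
  by rewrite lebesgue_too; [congr EFin; rewrite /u0; ring|rewrite /u0 gtr_pMl].
have AS0 : mu (A `\` S) = 0%E.
  have muAoo : (mu A < +oo)%E by rewrite muA ltry.
  by rewrite (measureD mA mS muAoo) [X in (X - _)%E]muA [X in (_ - X)%E]muAS subee.
have [z Sz] : S !=set0.
  apply/set0P/negP => /eqP S0; have := mu_cell 0 i0; rewrite -/S S0 measure0.
  by move=> [m0]; have := m_gt0 0; rewrite -m0 ltxx.
have := stopping_time_decay idx_nested m_gt0 mcell mu_cell null_criterion
  D_measurable mu_D D_nested mU Pp_measurable Pm_measurable mu_Pp mu_Pm
  Pp_U Pm_U cell_Pp Pm_Pp vK0 vK1 Pm_below cell_D J_gt0 (ler0n _ _)
  s_gt0 s_le s_K0 s_K1 s_r mf w_gt0 hup hlow k 0%N Sz.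
rewrite (_ : idx 0 z = i0)// /ck xc0 tc0 ell0 EFinM -muA.
set F := [set y | _]; move=> hS.
have mAS : measurable (A `\` S) by exact: measurableD.
apply: le_trans hS; rewrite -[leRHS]adde0 -AS0.
have mSF : measurable (S `&` F) by exact: mgt.
apply: le_trans (measureU2 _ mSF mAS); apply: le_measure; rewrite ?inE.
- exact: mgt.
- exact: measurableU.
- move=> y [Ay Fy]; have [Sy|nSy] := pselect (S y); first by left.
  by right.
Qed.

End one_sided.

(** * From medians to level-set bounds *)

Section medians.
Context {R : realType} (n : nat).
Local Notation X := (spacetime R n).
Local Notation mu := (@lebesgue_spacetime R n).

Lemma le_lebesgue_spacetime (A C : set X) : A `<=` C -> (mu A <= mu C)%E.
Proof.
pose mu2 : {measure set _ -> \bar R} := (lebesgue_tuple R n \x @lebesgue_measure R)%E.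
exact: (@le_outer_measure _ _ (mu_ext mu2)).
Qed.

Lemma max_median_lt (s w : R) (E : set X) (g : X -> \bar R) :
  (max_median s E g < w%:E)%E ->
  (mu (E `&` [set z | (w%:E < g z)%E]) <= s%:E * mu E)%E.
Proof.
move=> /ereal_inf_lt[_ [a ha <-]]; rewrite lte_fin => aw.
apply: le_trans (ltW ha); apply: le_lebesgue_spacetime => z [Ez gz]; split => //.
by apply: lt_trans gz; rewrite lte_fin.
Qed.

(** At a negative level the superlevel set is all of [E], so the level is not admissible when
    [s <= 1]. Hence each of the two medians in the oscillation is bounded by their sum. *)
Lemma max_median_ge0 (s : R) (E : set X) (g : X -> \bar R) :
  s <= 1 -> (forall z, (0 <= g z)%E) -> (0 <= max_median s E g)%E.
Proof.
move=> s1 g0; apply: le_ereal_inf_tmp => _ [a ha <-].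
rewrite lee_fin leNgt; apply/negP => a0; move: ha; apply/negP; rewrite -leNgt.
rewrite (_ : _ `&` _ = E).
  by rewrite -[leRHS]mul1e; apply: lee_wpmul2r; rewrite ?lee_fin//; exact: mu_ext_ge0.
apply/setIidl => z _; apply: lt_le_trans (g0 z).
by rewrite lte_fin.
Qed.

Lemma lt_recentered_funepos (f : X -> \bar R) (c a : R) z : 0 <= a ->
  (a%:E < (recentered f c)^\+ z)%E = ((c + a)%:E < f z)%E.
Proof.
move=> a0; rewrite funeposE /recentered lt_max [(a%:E < 0)%E]ltNge lee_fin a0 orbF.
by rewrite lteBrDr// -EFinD addrC.
Qed.

Lemma lt_recentered_funeneg (f : X -> \bar R) (c a : R) z : 0 <= a ->
  (a%:E < (recentered f c)^\- z)%E = (f z < (c - a)%:E)%E.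
Proof.
move=> a0; rewrite funenegE /recentered lt_max [(a%:E < 0)%E]ltNge lee_fin a0 orbF.
by rewrite lteNr lteBlDr// -EFinN -EFinD addrC.
Qed.

Lemma median_oscillation_lt (p gamma s w : R) (f : X -> \bar R) x t L :
  s <= 1 -> 0 < w ->
  (median_oscillation p gamma s f x t L < w%:E)%E -> exists c : R,
  (mu (prect_upper p gamma x t L `&` [set z | ((c + w)%:E < f z)%E]) <=
     s%:E * mu (prect_upper p gamma x t L))%E /\
  (mu (prect_lower p gamma x t L `&` [set z | (f z < (c - w)%:E)%E]) <=
     s%:E * mu (prect_lower p gamma x t L))%E.
Proof.
move=> s1 w0 /ereal_inf_lt[_ [c _ <-] lt]; exists c.
have upos : (0 <= max_median s (prect_upper p gamma x t L) (recentered f c)^\+)%E.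
  by apply: max_median_ge0.
have lpos : (0 <= max_median s (prect_lower p gamma x t L) (recentered f c)^\-)%E.
  by apply: max_median_ge0.
split.
- have := max_median_lt (le_lt_trans (leeDl _ lpos) lt).
  by under eq_set do rewrite lt_recentered_funepos ?ltW//.
- have := max_median_lt (le_lt_trans (leeDr _ upos) lt).
  by under eq_set do rewrite lt_recentered_funeneg ?ltW//.
Qed.

End medians.

(** * Choice of the constants and assembly of both sides *)

Lemma expR_truncn_le (R : realType) (a : R) : 0 <= a ->
  expR (-1) ^+ Num.truncn a <= expR 1 * expR (- a).
Proof.
move=> a0; rewrite -expRM_natl -expRD ler_expR.
by have /andP[_] := truncn_itv a0; rewrite -natr1; lra.
Qed.

Theorem theorem6p6 (R : realType) (n : nat) (p gamma alpha : R)
    (hn : (1 <= n)%N) (hp : 1 < p) (hgamma : 0 <= gamma < 1)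
    (halpha : gamma < alpha < 1) :
  exists2 s0 : R, 0 < s0 <= 1 &
  exists A B : R, [/\ 0 < A, 0 < B &
    forall s : R, 0 < s <= s0 ->
    forall (x : n.-tuple R) (t L : R), 0 < L ->
    forall f : spacetime R n -> \bar R,
      pbmo p gamma s (prect p x t L) f ->
      (0 < pbmo_norm p gamma s (prect p x t L) f)%E ->
    exists c : R, forall lambda : R, 0 < lambda ->
      let decay :=
        A * expR (- (B * lambda / fine (pbmo_norm p gamma s (prect p x t L) f))) in
      (lebesgue_spacetime (prect_upper p alpha x t L `&`
           [set z | (lambda%:E < (recentered f c)^\+ z)%E]) <=
         decay%:E * lebesgue_spacetime (prect_upper p alpha x t L))%E /\
      (lebesgue_spacetime (prect_lower p alpha x t L `&`
           [set z | (lambda%:E < (recentered f c)^\- z)%E]) <=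
         decay%:E * lebesgue_spacetime (prect_lower p alpha x t L))%E].
Proof.
have /andP[gamma0 gamma1] := hgamma; have /andP[gamma_alpha alpha1] := halpha.
have ag0 : 0 < alpha - gamma by rewrite subr_gt0.
have a10 : 0 < 1 - alpha by rewrite subr_gt0.
have archi (a e : R) : 0 <= a -> 0 < e -> exists N, a <= e * N%:R.
  move=> a0 e0; exists (Num.truncn (a / e)).+1; rewrite mulrC -ler_pdivrMr//.
  by have /andP[_ /ltW] := truncn_itv (divr_ge0 a0 (ltW e0)).
have [N hN] := archi 2 _ (ler0n _ 2) ag0.
have [J hJ] := archi 4 _ (ler0n _ 4) a10.
pose K0 := 2 * (1 - gamma) / (1 - alpha).
pose K1 := N%:R ^+ n * N%:R `^ p : R.
have K0_ge0 : 0 <= K0 by rewrite divr_ge0 ?mulr_ge0 ?subr_ge0 ?ltW.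
have K1_ge0 : 0 <= K1 by rewrite mulr_ge0 ?powR_ge0.
pose K2 := J%:R * (2 * J%:R) * K0.
have K2_ge0 : 0 <= K2 by rewrite mulr_ge0// mulr_ge0// mulr_ge0.
(* One constant dominating everything that multiplies [s]: the bound on [s * C] yields all the
   smallness conditions at once, with decay ratio [expR (-1)] per step. *)
pose C := 1 + K0 + K1 + K2.
have C1 : 1 <= C by rewrite /C; lra.
have e1 : expR (-1) <= 1 :> R by rewrite -[leRHS]expR0 ler_expR lerN10.
have e0 : 0 < expR (-1) :> R := expR_gt0 _.
have C0 : 0 < 4 * C by lra.
exists (expR (-1) / (4 * C)).
  rewrite divr_gt0//= ler_pdivrMr// mul1r; lra.
(* A step raises the level by [4 * w], which is 8 times the norm, whence [B]; rounding the number of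
   steps down costs the factor [A]. *)
exists (expR 1), 8^-1; split; [exact: expR_gt0|by []|].
move=> s /andP[s0 ss0] x t L L0 f [mf normoo] norm0.
set U := prect p x t L in mf normoo norm0 *.
set nu := fine _.
have nuE : pbmo_norm p gamma s U f = nu%:E by rewrite fineK// gt0_fin_numE.
have nu0 : 0 < nu by rewrite -lte_fin -nuE.
have sC : s * C <= expR (-1) / 4.
  by move: ss0; rewrite ler_pdivlMr// => h; rewrite ler_pdivlMr//; lra.
have sK K : K <= C -> s * K <= expR (-1) / 4.
  by move=> KC; apply: le_trans sC; rewrite ler_pM2l.
have sK0 : s * K0 <= expR (-1) / 4 by apply: sK; rewrite /C; lra.
have sK1 : s * K1 <= expR (-1) / 4 by apply: sK; rewrite /C; lra.
have sK2 : s * K2 <= expR (-1) / 4 by apply: sK; rewrite /C; lra.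
have s4 : s <= expR (-1) / 4.
  by rewrite -[s]mulr1; exact: sK.
(* Strictly above the norm, so that some constant has medians summing to less than [w] even if the
   infimum is not attained. *)
pose w := 2 * nu; have w0 : 0 < w by rewrite mulr_gt0.
have /choice[c hc] : forall z : n.-tuple R * R * R, exists c : R,
    0 < z.2 -> prect p z.1.1 z.1.2 z.2 `<=` U ->
  (lebesgue_spacetime (prect_upper p gamma z.1.1 z.1.2 z.2 `&`
      [set y | ((c + w)%:E < f y)%E]) <=
     s%:E * lebesgue_spacetime (prect_upper p gamma z.1.1 z.1.2 z.2))%E /\
  (lebesgue_spacetime (prect_lower p gamma z.1.1 z.1.2 z.2 `&`
      [set y | (f y < (c - w)%:E)%E]) <=
     s%:E * lebesgue_spacetime (prect_lower p gamma z.1.1 z.1.2 z.2))%E.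
  move=> [[x' t'] L'] /=.
  have [[L'0 sub]|nL] := pselect (0 < L' /\ prect p x' t' L' `<=` U); last first.
    (* Arbitrary value for triples that do not give a rectangle inside [U]. *)
    by exists 0 => L'0 sub; exfalso; apply: nL.
  have [|||c hc] := @median_oscillation_lt R n p gamma s w f x' t' L'.
  - by lra.
  - by [].
  - apply: (@le_lt_trans _ _ nu%:E); last by rewrite lte_fin /w; lra.
    by rewrite -nuE; apply: ereal_sup_ubound; exists x', t', L'.
  - by exists c.
have s12 : s <= 2^-1 by lra.
have sK0' : s * K0 < 1 by lra.
have sK1' : s * K1 < 2^-1 by lra.
have sK2' : J%:R * (2 * J%:R) * (s * K0) <= expR (-1).
  by rewrite mulrCA -/K2; lra.
have upper k := @one_sided_decay R n false p gamma alpha N J x t L hp gamma0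
  gamma_alpha alpha1 hN hJ L0 s w _ f (fun x' t' L' => c (x', t', L'))
  s0 s12 sK0' sK1' sK2' w0 mf
  (fun x' t' L' L'0 sub => (hc (x', t', L') L'0 sub).1)
  (fun x' t' L' L'0 sub => (hc (x', t', L') L'0 sub).2) k.
(* Passing to [- f] with time reversed exchanges the upper and lower hypotheses and negates the
   constants. *)
have lower k : (lebesgue_spacetime (prect_lower p alpha x t L `&`
      [set z | (f z < (c (x, t, L) - 4 * w * k%:R)%:E)%E]) <=
    (expR (-1) ^+ k)%:E * lebesgue_spacetime (prect_lower p alpha x t L))%E.
  have lt_opp (a e : R) : [set y | ((- a + e)%:E < - f y)%E] =
      [set y | (f y < (a - e)%:E)%E].
    by apply: eq_set => y; rewrite lteNr -EFinN opprD opprK.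
  have gt_opp (a e : R) : [set y | (- f y < (- a - e)%:E)%E] =
      [set y | ((a + e)%:E < f y)%E].
    by apply: eq_set => y; rewrite lteNl -EFinN opprB opprK addrC.
  rewrite -lt_opp.
  apply: (@one_sided_decay R n true p gamma alpha N J x t L hp gamma0
    gamma_alpha alpha1 hN hJ L0 s w _ (fun z => - f z)%E
    (fun x' t' L' => - c (x', t', L')) s0 s12 sK0' sK1' sK2' w0).
  - exact: measurableT_comp.
  - by move=> x' t' L' L'0 sub; rewrite lt_opp; exact: (hc (x', t', L') L'0 sub).2.
  - by move=> x' t' L' L'0 sub; rewrite gt_opp; exact: (hc (x', t', L') L'0 sub).1.
exists (c (x, t, L)) => lambda lambda0 decay.
(* The number of whole steps of height [4 * w] below [lambda]. *)
pose k := Num.truncn (lambda / (4 * w)).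
have w40 : 0 < 4 * w by rewrite mulr_gt0.
have lw0 : 0 <= lambda / (4 * w) by rewrite divr_ge0// ltW.
have kl : 4 * w * k%:R <= lambda.
  by rewrite mulrC -ler_pdivlMr//; have /andP[] := truncn_itv lw0.
have kdecay : expR (-1) ^+ k <= decay.
  rewrite /decay (_ : 8^-1 * lambda / nu = lambda / (4 * w)).
    exact: expR_truncn_le.
  by rewrite /w; field; rewrite lt0r_neq0.
have final (S F G : set (spacetime R n)) : F `<=` G ->
    (lebesgue_spacetime (S `&` G) <= (expR (-1) ^+ k)%:E * lebesgue_spacetime S)%E ->
    (lebesgue_spacetime (S `&` F) <= decay%:E * lebesgue_spacetime S)%E.
  move=> FG SG; apply: (@le_trans _ _ (lebesgue_spacetime (S `&` G))).
    by apply: le_lebesgue_spacetime; exact: setIS.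
  apply: le_trans SG _; apply: lee_wpmul2r; last by rewrite lee_fin.
  exact: mu_ext_ge0.
split.
- apply: final (upper k) => z /=; rewrite lt_recentered_funepos ?ltW//.
  by apply: le_lt_trans; rewrite lee_fin lerD2l.
- apply: final (lower k) => z /=; rewrite lt_recentered_funeneg ?ltW//.
  by move=> /lt_le_trans; apply; rewrite lee_fin lerD2l lerN2.
Qed.
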